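(* Let $m,n\ge 1$ be integers. If $n>m$, then $\mathrm{Ext}^1(C^{\otimes m},C^{\otimes n})$ has the structure of a $t$-module, and there is an exact sequence of $t$-modules $$0\to C^{\otimes(n-m)}\to\mathrm{Ext}^1(C^{\otimes m},C^{\otimes n})\to L\to 0,$$ where $L$ is an $m$-dimensional iterated extension of $\mathbb{G}_a$. Moreover, $\mathrm{Ext}^1_0(C^{\otimes m},C^{\otimes n})\cong C^{\otimes(n-m)}$.
   Context: Let $K \supseteq \mathbb{F}_q$ be a perfect field of characteristic $p>0$, $q$ a power of $p$, and fix an $\mathbb{F}_q$-linear ring homomorphism $\iota:\mathbb{F}_q[t]\to K$; put $\theta=\iota(t)$. $K\{\tau\}$ is the ring of twisted polynomials, $\tau x = x^q\tau$ for $x\in K$; $\tau$ acts on $\mathbb{G}_a$ as $x\mapsto x^q$. A $d$-dimensional $t$-module over $K$ is an algebraic group $E$ over $K$, isomorphic to $\mathbb{G}_a^d$, with an $\mathbb{F}_q$-linear endomorphism $t$ such that $d(t-\theta)^n\,\mathrm{Lie}(E)=0$ for large $n$. In coordinates, $E=(\mathbb{G}_a^d,\Phi)$ with $\Phi:\mathbb{F}_q[t]\to \mathrm{Mat}_d(K\{\tau\})$ an $\mathbb{F}_q$-linear ring homomorphism such that $\Phi(t)=(\theta I_d+N)+M_1\tau+\cdots$ with $N$ nilpotent. The $t$-module $\mathbb{G}_a$ carries the action of $t$ as multiplication by $\theta$. The $n$-th tensor power of the Carlitz module is the $n$-dimensional $t$-module $C^{\otimes n}$ with $C^{\otimes n}(t)=\theta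 I_n+N_n+E_n\tau$, where $N_n$ is the $n\times n$ matrix with $1$'s on the superdiagonal and zeros elsewhere, and $E_n$ is the $n\times n$ matrix with a single $1$ in the lower left corner $(n,1)$ and zeros elsewhere (so $C^{\otimes 1}=C$, $C(t)=\theta+\tau$). $\mathrm{Ext}^1(E,F)$ is the group (under Baer sum) of Yoneda equivalence classes of $t$-module extensions $0\to F\to X\to E\to 0$. It is an $\mathbb{F}_q[t]$-module through the endomorphisms of $E$ (pullback) or, equivalently, of $F$ (pushout). Explicitly, if $E=(\mathbb{G}_a^d,\Phi)$, $F=(\mathbb{G}_a^e,\Psi)$, a $(\Phi,\Psi)$-biderivation is an $\mathbb{F}_q$-linear map $\delta:\mathbb{F}_q[t]\to\mathrm{Mat}_{e\times d}(K\{\tau\})$ with $\delta(ab)=\Psi(a)\delta(b)+\delta(a)\Phi(b)$; it defines the extension $a\mapsto\begin{pmatrix}\Phi(a)&0\\ \delta(a)&\Psi(a)\end{pmatrix}$, and it is inner if $\delta(a)=U\Phi(a)-\Psi(a)U$ for some $U\in \mathrm{Mat}_{e\times d}(K\{\tau\})$. $\mathrm{Ext}^1(E,F)$ is identified with biderivations modulo inner biderivations, with $b\in\mathbb{F}_q[t]$ acting by $\delta\mapsto\Psi(b)\delta(\cdot)$ (equivalently $\delta(\cdot)\Phi(b)$). $\mathrm{Ext}^1_0(E,F)\subseteq\mathrm{Ext}^1(E,F)$ is the $\mathbb{F}_q[t]$-submodule of classes represented by biderivations $\delta$ for which $\delta(t)$ has zero constant term in $\tau$. Saying that an $\mathbb{F}_q[t]$-module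 has the structure of a $t$-module means that it is identified, as an $\mathbb{F}_q[t]$-module, with the $K$-points of a $t$-module over $K$. *)

(* Defs.v *)
From HB Require Import structures.
From mathcomp Require Import all_boot all_order all_algebra all_field.
From mathcomp Require Import boolp functions zify.

Set Implicit Arguments.
Unset Strict Implicit.
Unset Printing Implicit Defensive.

Import GRing.Theory.
Local Open Scope ring_scope.

(* Twisted polynomials \sum_i a_i t^i over R, with t * x = s x * t.           *)
(* They are carried by {poly R}, but only the additive structure is shared.   *)
Definition skew_poly (R : nzRingType) (s : {rmorphism R -> R}) : Type :=
  {poly R}.

Section SkewPoly.
Variables (R : nzRingType) (s : {rmorphism R -> R}).

Local Notation skew_poly := (skew_poly s).

HB.instance Definition _ := GRing.Zmodule.copy skew_poly {poly R}.

Implicit Types f g h : skew_poly.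

Definition skew_const (c : R) : skew_poly := c%:P.

Definition skew_var : skew_poly := 'X.

Definition skew_mul f g : skew_poly :=
  \poly_(k < (size f + size g)%N) \sum_(i < k.+1) f`_i * iter i s g`_(k - i).

Lemma iter_rmorph0 i : iter i s 0 = 0.
Proof. by elim: i => //= i ->; rewrite rmorph0. Qed.

Lemma iter_rmorph1 i : iter i s 1 = 1.
Proof. by elim: i => //= i ->; rewrite rmorph1. Qed.

Lemma iter_rmorphD i : {morph iter i s : x y / x + y}.
Proof. by move=> x y; elim: i => //= i ->; rewrite rmorphD. Qed.

Lemma iter_rmorphM i : {morph iter i s : x y / x * y}.
Proof. by move=> x y; elim: i => //= i ->; rewrite rmorphM. Qed.

Lemma iter_rmorph_sum i I r (P : pred I) (E : I -> R) :
  iter i s (\sum_(j <- r | P j) E j) = \sum_(j <- r | P j) iter i s (E j).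
Proof. exact: (big_morph _ (iter_rmorphD i) (iter_rmorph0 i)). Qed.

Lemma coef_skew_mul f g k :
  (skew_mul f g)`_k = \sum_(i < k.+1) f`_i * iter i s g`_(k - i).
Proof.
rewrite coef_poly; case: ltnP => // le_k; rewrite big1 // => i _.
have [le_i|lt_i] := leqP (size f) i; first by rewrite nth_default ?mul0r.
rewrite [g`_ _]nth_default ?iter_rmorph0 ?mulr0 //.
by have := leq_sub le_k (ltnW lt_i); rewrite addKn.
Qed.

Lemma coef_skew_mul_rev f g k :
  (skew_mul f g)`_k = \sum_(i < k.+1) f`_(k - i) * iter (k - i) s g`_i.
Proof.
rewrite coef_skew_mul (reindex_inj rev_ord_inj) /=.
by apply: eq_bigr => i _; rewrite (sub_ordK i).
Qed.

Fact skew_mulA : associative skew_mul.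
Proof.
move=> p q r; apply/polyP => i; rewrite coef_skew_mul coef_skew_mul_rev.
pose coef3 j k := p`_j * (iter j s q`_(i - j - k)%N * iter (i - k) s r`_k).
transitivity (\sum_(j < i.+1) \sum_(k < i.+1 | (k <= i - j)%N) coef3 j k).
  apply: eq_bigr => /= j _; rewrite coef_skew_mul_rev iter_rmorph_sum big_distrr.
  rewrite (big_ord_narrow_leq (leq_subr _ _)); apply: eq_bigr => k _ /=.
  rewrite iter_rmorphM -iterD /coef3; congr (_ * (_ * iter _ s _)).
  by have /= := ltn_ord j; have /= := ltn_ord k; lia.
rewrite (exchange_big_dep predT) //=; apply: eq_bigr => k _.
transitivity (\sum_(j < i.+1 | (j <= i - k)%N) coef3 j k).
  apply: eq_bigl => j; rewrite -ltnS -(ltnS j) -!subSn ?leq_ord //.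
  by rewrite -subn_gt0 -(subn_gt0 j) -!subnDA addnC.
rewrite (big_ord_narrow_leq (leq_subr _ _)) coef_skew_mul big_distrl /=.
by apply: eq_bigr => j _; rewrite /coef3 -!subnDA addnC mulrA.
Qed.

Fact skew_mul1l : left_id (skew_const 1) skew_mul.
Proof.
move=> p; apply/polyP => i; rewrite coef_skew_mul big_ord_recl subn0 /=.
by rewrite coefC /= mul1r big1 ?addr0 // => j; rewrite coefC /= mul0r.
Qed.

Fact skew_mul1r : right_id (skew_const 1) skew_mul.
Proof.
move=> p; apply/polyP => i; rewrite coef_skew_mul_rev big_ord_recl subn0 /=.
rewrite coefC /= iter_rmorph1 mulr1 big1 ?addr0 // => j _.
by rewrite coefC /= iter_rmorph0 mulr0.
Qed.

Fact skew_mulDl : left_distributive skew_mul +%R.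
Proof.
move=> p q r; apply/polyP => i; rewrite coefD !coef_skew_mul -big_split /=.
by apply: eq_bigr => j _; rewrite coefD mulrDl.
Qed.

Fact skew_mulDr : right_distributive skew_mul +%R.
Proof.
move=> p q r; apply/polyP => i; rewrite coefD !coef_skew_mul -big_split /=.
by apply: eq_bigr => j _; rewrite coefD iter_rmorphD mulrDr.
Qed.

Fact skew_one_neq0 : skew_const 1 != 0 :> skew_poly.
Proof. by rewrite polyC_eq0 oner_eq0. Qed.

HB.instance Definition _ := GRing.Zmodule_isNzRing.Build skew_poly
  skew_mulA skew_mul1l skew_mul1r skew_mulDl skew_mulDr skew_one_neq0.

Lemma skew_varM (c : R) : skew_var * skew_const c = skew_const (s c) * skew_var.
Proof.
apply/polyP => k; rewrite [LHS]coef_skew_mul [RHS]coef_skew_mul.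
rewrite [RHS]big_ord_recl [X in _ = _ + X]big1 => [|i _]; last first.
  by rewrite coefC mul0r.
rewrite addr0 subn0 [(skew_const _)`_ord0]coefC coefX /=.
case: k => [|k]; first by rewrite big_ord1 coefX mul0r mulr0.
rewrite big_ord_recl coefX mul0r add0r big_ord_recl /= big1 => [|i _]; last first.
  by rewrite coefX mul0r.
rewrite addr0 coefX mul1r subn1 coefC /= eqSS.
by case: k => [|k]; rewrite ?mulr1 // rmorph0 mulr0.
Qed.

End SkewPoly.

Arguments skew_const {R} s c.
Arguments skew_var {R} s.

Section QFrobenius.
Variables (F : finFieldType) (K : comNzRingType) (emb : {rmorphism F -> K}).

Lemma pnat_card_finField : [pchar K].-nat #|F|.
Proof.
have [p p_pr pF] := finPcharP F.
rewrite (eq_pnat _ (pcharf_eq (rmorph_pchar emb pF))).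
by rewrite (card_pprimeChar pF) pnatX pnat_id.
Qed.

Definition qfrob of {rmorphism F -> K} : K -> K := fun x => x ^+ #|F|.

Fact qfrob_is_nmod_morphism : nmod_morphism (qfrob emb).
Proof.
split=> [|x y]; last exact/exprDn_pchar/pnat_card_finField.
by rewrite /qfrob expr0n gtn_eqF // (ltnW (finNzRing_gt1 F)).
Qed.

Fact qfrob_is_monoid_morphism : monoid_morphism (qfrob emb).
Proof. by split=> [|x y]; rewrite /qfrob ?expr1n ?exprMn. Qed.

HB.instance Definition _ :=
  GRing.isNmodMorphism.Build K K (qfrob emb) qfrob_is_nmod_morphism.
HB.instance Definition _ :=
  GRing.isMonoidMorphism.Build K K (qfrob emb) qfrob_is_monoid_morphism.

Lemma iter_qfrob i x : iter i (qfrob emb) x = x ^+ (#|F| ^ i).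
Proof. by elim: i => [|i /= ->]; rewrite ?expr1 // /qfrob -exprM -expnSr. Qed.

End QFrobenius.

(* K{tau} *)
Notation twisted emb := (skew_poly (qfrob emb)).

Section Eval.
Variables (F : finFieldType) (K : fieldType) (emb : {rmorphism F -> K}).
Variable R : comAlgType K.
Implicit Types (f g : twisted emb) (x y : R).

Local Notation q := #|F|.

(* The action of K{tau} on the R-points of the additive group. *)
Definition tau_eval f x : R := \sum_(i < size f) f`_i *: x ^+ (q ^ i).

Lemma tau_eval_wide n f x :
  (size f <= n)%N -> tau_eval f x = \sum_(i < n) f`_i *: x ^+ (q ^ i).
Proof.
move=> le_n; rewrite /tau_eval (big_ord_widen n (fun i => f`_i *: x ^+ (q ^ i))) //.
rewrite big_mkcond; apply: eq_bigr => i _; case: ltnP => // le_i.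
by rewrite nth_default // scale0r.
Qed.

Lemma expr_qD i : {morph (fun x : R => x ^+ (q ^ i)) : x y / x + y}.
Proof.
move=> x y /=; apply: exprDn_pchar.
by rewrite pnatX (pnat_card_finField (GRing.in_alg R \o emb)).
Qed.

Lemma expr_q0 i : (0 : R) ^+ (q ^ i) = 0.
Proof. by rewrite expr0n expn_eq0 gtn_eqF // (ltnW (finNzRing_gt1 F)). Qed.

Lemma tau_evalDr f : {morph tau_eval f : x y / x + y}.
Proof.
move=> x y; rewrite /tau_eval -big_split /=; apply: eq_bigr => i _.
by rewrite expr_qD scalerDr.
Qed.

Lemma tau_eval0r f : tau_eval f 0 = 0.
Proof. by rewrite /tau_eval big1 // => i _; rewrite expr_q0 scaler0. Qed.

Lemma tau_evalDl f g x : tau_eval (f + g) x = tau_eval f x + tau_eval g x.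
Proof.
pose n := maxn (size f) (size g).
rewrite (@tau_eval_wide n) ?size_polyD // (@tau_eval_wide n f) ?leq_maxl //.
rewrite (@tau_eval_wide n g) ?leq_maxr // -big_split /=.
by apply: eq_bigr => i _; rewrite coefD scalerDl.
Qed.

Lemma tau_eval0l x : tau_eval 0 x = 0.
Proof. by rewrite (@tau_eval_wide 0) ?size_poly0 // big_ord0. Qed.

Lemma tau_eval_const c x : tau_eval (skew_const (qfrob emb) c) x = c *: x.
Proof.
by rewrite (@tau_eval_wide 1) ?size_polyC_leq1 // big_ord1 coefC expr1.
Qed.

Lemma tau_evalM f g x : tau_eval (f * g) x = tau_eval f (tau_eval g x).
Proof.
pose n := (size f + size g)%N.
rewrite (@tau_eval_wide n) ?size_poly // (@tau_eval_wide n f) ?leq_addr //.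
transitivity (\sum_(k < n) \sum_(i < n | (i <= k)%N)
    (f`_i * iter i (qfrob emb) g`_(k - i)) *: x ^+ (q ^ k)).
  apply: eq_bigr => k _; rewrite [_`_k]coef_skew_mul scaler_suml.
  rewrite (big_ord_widen n (fun i =>
    (f`_i * iter i (qfrob emb) g`_(k - i)) *: x ^+ (q ^ k))) //.
rewrite (exchange_big_dep predT) //=; apply: eq_bigr => i _.
rewrite [tau_eval g x]/tau_eval (big_morph _ (expr_qD i) (expr_q0 i)) scaler_sumr.
have [le_i|lt_i] := leqP (size f) i.
  by rewrite nth_default // !big1 // => *; rewrite ?mul0r scale0r.
pose G j := (f`_i * iter i (qfrob emb) g`_j) *: x ^+ (q ^ (j + i)).
transitivity (\sum_(j < size g) G j); last first.
  apply: eq_bigr => j _; rewrite /G iter_qfrob exprZn -exprM scalerA.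
  by rewrite -expnD.
rewrite -(big_geq_mkord i n predT (fun k =>
  (f`_i * iter i (qfrob emb) g`_(k - i)) *: x ^+ (q ^ k))).
rewrite -{1}[nat_of_ord i]add0n big_addn big_mkord.
have le_g : (size g <= n - i)%N by rewrite leq_subRL ?leq_add2r ltnW.
rewrite (big_ord_widen _ G le_g) [RHS]big_mkcond; apply: eq_bigr => j _.
rewrite addnK; case: ltnP => // le_j.
by rewrite [g`_j]nth_default // iter_rmorph0 mulr0 scale0r.
Qed.

End Eval.

Section Matrices.
Variables (F : finFieldType) (K : fieldType) (emb : {rmorphism F -> K}).
Variable R : comAlgType K.

(* Differential at 0 of a homomorphism between powers of the additive group. *)
Definition lie d e (M : 'M[twisted emb]_(e, d)) : 'M[K]_(e, d) :=
  map_mx (fun f : twisted emb => f`_0) M.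

Definition tau_mulmx d e (M : 'M[twisted emb]_(e, d)) (v : 'cV[R]_d) :
    'cV[R]_e :=
  \col_i \sum_j tau_eval (M i j) (v j 0).

Lemma tau_mulmxDr d e (M : 'M[twisted emb]_(e, d)) :
  {morph tau_mulmx M : v w / v + w}.
Proof.
move=> v w; apply/matrixP => i j; rewrite !mxE -big_split /=.
by apply: eq_bigr => k _; rewrite mxE tau_evalDr.
Qed.

Lemma tau_mulmxDl d e (M N : 'M[twisted emb]_(e, d)) v :
  tau_mulmx (M + N) v = tau_mulmx M v + tau_mulmx N v.
Proof.
apply/matrixP => i j; rewrite !mxE -big_split /=.
by apply: eq_bigr => k _; rewrite mxE tau_evalDl.
Qed.

Lemma tau_mulmx1 d (v : 'cV[R]_d) : tau_mulmx (1%:M : 'M[twisted emb]_d) v = v.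
Proof.
apply/matrixP => i j; rewrite !mxE (bigD1 i) //= mxE eqxx tau_eval_const.
rewrite scale1r ord1 big1 ?addr0 // => k ne_ki.
by rewrite mxE eq_sym (negPf ne_ki) tau_eval0l.
Qed.

Lemma tau_mulmxA d e f (M : 'M[twisted emb]_(f, e)) (N : 'M_(e, d)) v :
  tau_mulmx M (tau_mulmx N v) = tau_mulmx (M *m N) v.
Proof.
apply/matrixP => i j; rewrite !mxE.
transitivity (\sum_j0 \sum_k tau_eval (M i j0 * N j0 k) (v k 0)).
  apply: eq_bigr => k _; rewrite mxE.
  rewrite (big_morph _ (tau_evalDr _) (tau_eval0r _ _)).
  by apply: eq_bigr => l _; rewrite tau_evalM.
rewrite exchange_big; apply: eq_bigr => k _; rewrite mxE.
apply/esym/(big_morph (fun f => tau_eval f (v k 0))) => [a b|].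
  exact: tau_evalDl.
exact: tau_eval0l.
Qed.

End Matrices.

Section TModules.
Variables (F : finFieldType) (K : fieldType) (emb : {rmorphism F -> K}).
Variable theta : K.

Local Notation Ktau := (twisted emb).
Local Notation tconst c := (skew_const (qfrob emb) c).
Local Notation tau := (skew_var (qfrob emb)).

(* A t-module structure on the d-th power of the additive group, that is, an *)
(* F-linear ring homomorphism from F[t] to the d x d matrices over K{tau}.   *)
Record tmodule (d : nat) := TModule {
  tact :> {rmorphism {poly F} -> 'M[Ktau]_d};
  tact_linear : forall c a, tact (c *: a) = tconst (emb c) *: tact a;
  tact_nilpotent : exists k, (lie (tact 'X) - theta%:M) ^+ k = 0
}.

Lemma tactM d (E : tmodule d) a b : E (a * b) = E a *m E b.
Proof. exact: rmorphM. Qed.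

Lemma tactC d (E : tmodule d) a b : E a *m E b = E b *m E a.
Proof. by rewrite -!tactM mulrC. Qed.

(* R-points of a t-module, for a commutative K-algebra R; the K-points are   *)
(* those with R = K^o.                                                       *)
Definition points d (E : tmodule d) (R : comAlgType K) : Type := 'cV[R]_d.

Section Points.
Variables (d : nat) (E : tmodule d) (R : comAlgType K).

HB.instance Definition _ := GRing.Zmodule.copy (points E R) 'cV[R]_d.

Definition points_scale (a : {poly F}) (v : points E R) : points E R :=
  tau_mulmx (E a) v.

Fact points_scaleA a b v :
  points_scale a (points_scale b v) = points_scale (a * b) v.
Proof. by rewrite /points_scale tau_mulmxA tactM. Qed.

Fact points_scale1 : left_id 1 points_scale.
Proof. by move=> v; rewrite /points_scale rmorph1 tau_mulmx1. Qed.

Fact points_scaleDr : right_distributive points_scale +%R.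
Proof. by move=> a v w; apply: tau_mulmxDr. Qed.

Fact points_scaleDl v : {morph points_scale^~ v : a b / a + b}.
Proof. by move=> a b; rewrite /points_scale rmorphD; apply: tau_mulmxDl. Qed.

HB.instance Definition _ := GRing.Zmodule_isLmodule.Build {poly F} (points E R)
  points_scaleA points_scale1 points_scaleDr points_scaleDl.

End Points.

Record tmorphism d e (E : tmodule d) (E' : tmodule e) := TMorphism {
  tmor_mx : 'M[Ktau]_(e, d);
  tmorP : forall a, tmor_mx *m E a = E' a *m tmor_mx
}.

Definition tmor_points d e (E : tmodule d) (E' : tmodule e)
    (f : tmorphism E E') (R : comAlgType K) (v : points E R) : points E' R :=
  tau_mulmx (tmor_mx f) v.

(* Exactness of 0 -> A -> B -> C -> 0 as a sequence of algebraic groups over *)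
(* K. The kernel A is a power of the additive group, which has no torsors    *)
(* over an affine base, so exactness can be tested on R-points for all R;    *)
(* K-points alone would not suffice (the map x |-> x ^ q on the additive     *)
(* group is bijective on K-points, since K is perfect).                      *)
Definition short_exact d1 d2 d3
    (A : tmodule d1) (B : tmodule d2) (C : tmodule d3)
    (f : tmorphism A B) (g : tmorphism B C) : Prop :=
  forall R : comAlgType K,
    [/\ injective (@tmor_points _ _ _ _ f R),
        forall y, @tmor_points _ _ _ _ g R y = 0
                  <-> exists x, y = tmor_points f x &
        forall z, exists y, @tmor_points _ _ _ _ g R y = z].

Section OfMatrix.
Variables (d : nat) (T : 'M[Ktau]_d).
Implicit Types (a b : {poly F}) (c : F).

Definition eval_mx a : 'M[Ktau]_d :=
  \sum_(i < size a) tconst (emb a`_i) *: T ^+ i.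

Lemma eval_mx_wide n a :
  (size a <= n)%N -> eval_mx a = \sum_(i < n) tconst (emb a`_i) *: T ^+ i.
Proof.
move=> le_n; rewrite /eval_mx.
rewrite (big_ord_widen n (fun i => tconst (emb a`_i) *: T ^+ i)) //.
rewrite big_mkcond; apply: eq_bigr => i _; case: ltnP => // le_i.
by rewrite nth_default // rmorph0 [skew_const _ _]polyC0 scale0r.
Qed.

Lemma tconstD x y : tconst (x + y) = tconst x + tconst y.
Proof. exact: polyCD. Qed.

Lemma tconstM x y : tconst (x * y) = tconst x * tconst y.
Proof.
apply/polyP => i; rewrite [RHS]coef_skew_mul big_ord_recl big1 => [|j _].
  rewrite addr0 subn0 !coefC /=; case: (i == 0)%N; rewrite ?mulr0 //.
by rewrite [X in X * _]coefC mul0r.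
Qed.

Lemma emb_frob c i : iter i (qfrob emb) (emb c) = emb c.
Proof.
elim: i => //= i ->; rewrite /qfrob -rmorphXn; congr (emb _).
exact: expf_card.
Qed.

Lemma tconst_central c (f : Ktau) :
  tconst (emb c) * f = f * tconst (emb c).
Proof.
apply/polyP => i; rewrite [LHS]coef_skew_mul [RHS]coef_skew_mul_rev.
rewrite !big_ord_recl !big1 => [|j _|j _]; last first.
- by rewrite coefC mul0r.
- by rewrite coefC /= iter_rmorph0 mulr0.
by rewrite !addr0 !subn0 !coefC /= emb_frob mulrC.
Qed.

Lemma tconst_mulmxr m n (A : 'M[Ktau]_(m, n)) c :
  A *m (tconst (emb c))%:M = tconst (emb c) *: A.
Proof.
rewrite -diag_const_mx mul_mx_diag; apply/matrixP => i j.
by rewrite !mxE tconst_central.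
Qed.

Lemma tconst_scalemxAr m n p (A : 'M[Ktau]_(m, n)) (B : 'M_(n, p)) c :
  A *m (tconst (emb c) *: B) = tconst (emb c) *: (A *m B).
Proof. by rewrite -mul_scalar_mx mulmxA tconst_mulmxr -scalemxAl. Qed.

Lemma eval_mxD : {morph eval_mx : a b / a + b}.
Proof.
move=> a b; pose n := maxn (size a) (size b).
rewrite (@eval_mx_wide n) ?size_polyD // (@eval_mx_wide n a) ?leq_maxl //.
rewrite (@eval_mx_wide n b) ?leq_maxr // -big_split /=.
by apply: eq_bigr => i _; rewrite coefD rmorphD tconstD scalerDl.
Qed.

Lemma eval_mxZ c a : eval_mx (c *: a) = tconst (emb c) *: eval_mx a.
Proof.
rewrite (@eval_mx_wide (size a)) ?size_scale_leq // scaler_sumr.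
by apply: eq_bigr => i _; rewrite coefZ rmorphM tconstM scalerA.
Qed.

Lemma eval_mx1 : eval_mx 1 = 1.
Proof.
rewrite (@eval_mx_wide 1) ?size_polyC_leq1 // big_ord1 coefC rmorph1.
exact: scale1r.
Qed.

Lemma eval_mxMX a : eval_mx (a * 'X) = eval_mx a * T.
Proof.
rewrite (@eval_mx_wide (size a).+1); last first.
  by rewrite (leq_trans (size_polyMleq _ _)) // size_polyX addn2.
rewrite big_ord_recl coefMX /= rmorph0 [skew_const _ _]polyC0 scale0r add0r.
rewrite /eval_mx mulr_suml; apply: eq_bigr => i _.
rewrite coefMX exprSr; exact: scalemxAl.
Qed.

Fact eval_mx_is_nmod_morphism : nmod_morphism eval_mx.
Proof.
by split=> [|a b]; [rewrite /eval_mx size_poly0 big_ord0 | apply: eval_mxD].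
Qed.

Fact eval_mx_is_monoid_morphism : monoid_morphism eval_mx.
Proof.
split=> [|a b]; first exact: eval_mx1.
elim/poly_ind: b => [|b c IH].
  by rewrite mulr0 eval_mx_is_nmod_morphism.1 mulr0.
rewrite mulrDr !eval_mxD mulrA !eval_mxMX IH mulrDr mulrA; congr (_ + _).
rewrite -[c%:P]alg_polyC -scalerAr mulr1 !eval_mxZ eval_mx1.
by rewrite [RHS]tconst_scalemxAr [_ *m _]mulr1.
Qed.

HB.instance Definition _ := GRing.isNmodMorphism.Build {poly F} 'M[Ktau]_d
  eval_mx eval_mx_is_nmod_morphism.
HB.instance Definition _ := GRing.isMonoidMorphism.Build {poly F} 'M[Ktau]_d
  eval_mx eval_mx_is_monoid_morphism.

Lemma eval_mxX : eval_mx 'X = T.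
Proof. by rewrite -['X]mul1r eval_mxMX eval_mx1 mul1r. Qed.

Hypothesis T_nilpotent : exists k, (lie T - theta%:M) ^+ k = 0.

Fact eval_mx_nilpotent : exists k, (lie (eval_mx 'X) - theta%:M) ^+ k = 0.
Proof. by rewrite eval_mxX. Qed.

Definition tmodule_of_mx : tmodule d := TModule eval_mxZ eval_mx_nilpotent.

End OfMatrix.

Lemma Ga_nilpotent :
  exists k, (lie (tconst theta)%:M - theta%:M : 'M[K]_1) ^+ k = 0.
Proof.
exists 1; apply/matrixP => i j.
by rewrite expr1 !mxE !ord1 eqxx !mulr1n coefC subrr.
Qed.

Definition Ga : tmodule 1 := tmodule_of_mx Ga_nilpotent.

Definition carlitz_mx n : 'M[Ktau]_n :=
  (tconst theta)%:M
  + \matrix_(i, j) (val j == (val i).+1)%:R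
  + \matrix_(i, j) (if ((val i).+1 == n) && (val j == 0)%N then tau else 0).

Lemma carlitz_nilpotent n :
  exists k, (lie (carlitz_mx n) - theta%:M) ^+ k = 0.
Proof.
exists n; rewrite (_ : lie _ - _ = \matrix_(i, j) (val j == (val i).+1)%:R).
  have powN k : (\matrix_(i < n, j < n) (val j == (val i).+1)%:R : 'M[K]_n) ^+ k
                = \matrix_(i, j) (val j == val i + k)%N%:R.
    elim: k => [|k IH].
      by apply/matrixP => i j; rewrite !mxE addn0 eq_sym.
    rewrite exprS IH; apply/matrixP => i j; rewrite !mxE.
    have [lt_i|le_i] := ltnP i.+1 n.
      rewrite (bigD1 (Ordinal lt_i)) //= !mxE eqxx mul1r addSnnS big1 ?addr0 //.
      move=> l ne_l; rewrite !mxE (_ : _ == _ = false) ?mul0r //.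
      by apply: contraNF ne_l => /eqP e; apply/eqP/val_inj.
    rewrite big1 => [|l _]; last first.
      rewrite !mxE (_ : _ == _ = false) ?mul0r //.
      by rewrite ltn_eqF // (leq_trans (ltn_ord l)).
    by rewrite ltn_eqF // (leq_trans (ltn_ord j)) // (leq_trans le_i) // addnS ltnS leq_addr.
  rewrite powN; apply/matrixP => i j; rewrite !mxE ltn_eqF //.
  by rewrite (leq_trans (ltn_ord j)) // leq_addl.
apply/matrixP => i j; rewrite !mxE !coefD.
rewrite [X in _ + X - _](_ : _ = 0); last by case: ifP; rewrite ?coefX ?coef0.
rewrite [X in X + _ + _ - _](_ : _ = theta *+ (i == j)); last first.
  by case: (i == j); rewrite ?coefC ?coef0.
rewrite addr0 addrC addKr.
by case: (_ == _); rewrite ?coefC ?coef0.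
Qed.

(* The n-th tensor power of the Carlitz module. *)
Definition carlitz n : tmodule n := tmodule_of_mx (carlitz_nilpotent n).

Lemma carlitzX n : carlitz n 'X = carlitz_mx n.
Proof. exact: eval_mxX. Qed.

(* Iterated extensions of Ga: each step adds a quotient isomorphic to Ga. *)
Inductive iterated_Ga : forall d, tmodule d -> Prop :=
| IteratedGa0 (L : tmodule 0) : iterated_Ga L
| IteratedGaS d (L' : tmodule d) (L : tmodule d.+1)
    (f : tmorphism L' L) (g : tmorphism L Ga) :
    iterated_Ga L' -> short_exact f g -> iterated_Ga L.

Section Ext.
Variables (d e : nat) (E : tmodule d) (G : tmodule e).
Implicit Types (a b : {poly F}).

Definition is_biderivation (delta : {poly F} -> 'M[Ktau]_(e, d)) : Prop :=
  (forall c a b, delta (c *: a + b) = tconst (emb c) *: delta a + delta b)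
  /\ (forall a b, delta (a * b) = G a *m delta b + delta a *m E b).

Definition biderivation_pred : {pred {poly F} -> 'M[Ktau]_(e, d)} :=
  fun delta => `[< is_biderivation delta >].

Fact biderivation_zmod_closed : zmod_closed biderivation_pred.
Proof.
split.
  apply/asboolP; split=> [c a b|a b]; rewrite /= ?scaler0 ?addr0 //.
  by rewrite mulmx0 mul0mx addr0.
move=> /= x y /asboolP[xL xM] /asboolP[yL yM].
apply/asboolP; split=> [c a b|a b] /=; rewrite !fctE.
  by rewrite xL yL scalerBr opprD addrACA.
by rewrite xM yM mulmxBl mulmxBr opprD addrACA.
Qed.

HB.instance Definition _ := GRing.isZmodClosed.Build _ biderivation_pred
  biderivation_zmod_closed.

(* Encodes the extension 0 -> G -> X -> E -> 0 in which a acts on X by the   *)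
(* block matrix with rows (E a, 0) and (delta a, G a).                       *)
Record biderivation := Biderivation {
  bider_fun :> {poly F} -> 'M[Ktau]_(e, d);
  biderP : bider_fun \in biderivation_pred
}.

HB.instance Definition _ := [isSub for bider_fun].
HB.instance Definition _ := [Choice of biderivation by <:].
HB.instance Definition _ := [SubChoice_isSubZmodule of biderivation by <:].

Fact bider_scale_subproof b (delta : biderivation) :
  (fun a => G b *m delta a) \in biderivation_pred.
Proof.
have /asboolP[dL dM] := biderP delta.
apply/asboolP; split=> [c a a'|a a'].
  by rewrite dL mulmxDr tconst_scalemxAr.
by rewrite dM mulmxDr !mulmxA (tactC G b a).
Qed.

Definition bider_scale b (delta : biderivation) : biderivation :=
  Biderivation (bider_scale_subproof b delta).

Fact bider_scaleA a b x : bider_scale a (bider_scale b x) = bider_scale (a * b) x.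
Proof.
by apply/val_inj/funext => c /=; rewrite mulmxA tactM.
Qed.

Fact bider_scale1 : left_id 1 bider_scale.
Proof. by move=> x; apply/val_inj/funext => c /=; rewrite rmorph1 mul1mx. Qed.

Fact bider_scaleDr : right_distributive bider_scale +%R.
Proof. by move=> a x y; apply/val_inj/funext => c /=; apply: mulmxDr. Qed.

Fact bider_scaleDl x : {morph bider_scale^~ x : a b / a + b}.
Proof.
by move=> a b; apply/val_inj/funext => c /=; rewrite rmorphD; apply: mulmxDl.
Qed.

HB.instance Definition _ := GRing.Zmodule_isLmodule.Build {poly F} biderivation
  bider_scaleA bider_scale1 bider_scaleDr bider_scaleDl.

Definition inner : {pred biderivation} := fun delta =>
  `[< exists U : 'M[Ktau]_(e, d), forall a, delta a = U *m E a - G a *m U >].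

Fact inner_submod_closed : submod_closed inner.
Proof.
split.
  by apply/asboolP; exists 0 => a; rewrite mul0mx mulmx0 subrr.
move=> b x y /asboolP[U xE] /asboolP[V yE].
apply/asboolP; exists (G b *m U + V) => a.
rewrite -[LHS]/(G b *m x a + y a) xE yE mulmxBr mulmxDl mulmxDr opprD addrACA.
by rewrite !mulmxA (tactC G b a).
Qed.

HB.instance Definition _ := GRing.isSubmodClosed.Build _ _ inner
  inner_submod_closed.

(* Ext^1(E, G) as biderivations modulo inner ones; the change of basis by a  *)
(* unipotent block U of an extension alters delta by an inner biderivation.  *)
(* F[t] acts through pushout along the action on G.                          *)
Definition Ext1 : Type := Quotient.quot inner.

HB.instance Definition _ := GRing.Zmodule.copy Ext1 (Quotient.quot inner).

Definition ext_class (delta : biderivation) : Ext1 :=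
  (\pi_(Quotient.quot inner) delta)%qT.

Lemma ext_class_eq x y : ext_class x = ext_class y <-> x - y \in inner.
Proof. by rewrite Quotient.idealrBE; split=> /eqP. Qed.

Lemma ext_class_surj (x : Ext1) : exists delta, x = ext_class delta.
Proof. by exists (repr (x : Quotient.quot inner)); rewrite /ext_class reprK. Qed.

Lemma ext_classD : {morph ext_class : x y / x + y}.
Proof. by move=> x y; rewrite /ext_class !piE. Qed.

Definition Ext1_scale b (x : Ext1) : Ext1 :=
  ext_class (b *: repr (x : Quotient.quot inner)).

Lemma Ext1_scaleE b delta : Ext1_scale b (ext_class delta) = ext_class (b *: delta).
Proof.
apply/ext_class_eq; rewrite -scalerBr rpredZ //.
by apply/ext_class_eq; rewrite /ext_class reprK.
Qed.

Fact Ext1_scaleA a b x : Ext1_scale a (Ext1_scale b x) = Ext1_scale (a * b) x.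
Proof. by have [y ->] := ext_class_surj x; rewrite !Ext1_scaleE scalerA. Qed.

Fact Ext1_scale1 : left_id 1 Ext1_scale.
Proof.
by move=> x; have [y ->] := ext_class_surj x; rewrite Ext1_scaleE scale1r.
Qed.

Fact Ext1_scaleDr : right_distributive Ext1_scale +%R.
Proof.
move=> a x y; have [x' ->] := ext_class_surj x; have [y' ->] := ext_class_surj y.
by rewrite -ext_classD !Ext1_scaleE scalerDr ext_classD.
Qed.

Fact Ext1_scaleDl x : {morph Ext1_scale^~ x : a b / a + b}.
Proof.
move=> a b /=; have [y ->] := ext_class_surj x.
by rewrite !Ext1_scaleE scalerDl ext_classD.
Qed.

HB.instance Definition _ := GRing.Zmodule_isLmodule.Build {poly F} Ext1
  Ext1_scaleA Ext1_scale1 Ext1_scaleDr Ext1_scaleDl.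

Definition Ext10_pred : {pred Ext1} := fun x =>
  `[< exists delta : biderivation,
        lie (delta 'X) = 0 /\ x = ext_class delta >].

Fact Ext10_submod_closed : submod_closed Ext10_pred.
Proof.
split.
  apply/asboolP; exists 0; split; last by rewrite /ext_class !piE.
  by apply/matrixP => i j; rewrite !mxE coef0.
move=> b x y /asboolP[x' [x0 ->]] /asboolP[y' [y0 ->]].
apply/asboolP; exists (b *: x' + y'); split; last first.
  by rewrite ext_classD -Ext1_scaleE.
apply/matrixP => i j; rewrite !mxE coefD.
move/matrixP/(_ i j): y0; rewrite !mxE => ->; rewrite addr0 coef_sum big1 // => k _.
rewrite [LHS]coef_skew_mul big_ord1.
by move/matrixP/(_ k j): x0; rewrite !mxE => /= ->; rewrite mulr0.
Qed.

HB.instance Definition _ := GRing.isSubmodClosed.Build _ _ Ext10_pred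
  Ext10_submod_closed.

Definition Ext10 : Type := {x : Ext1 | x \in Ext10_pred}.

HB.instance Definition _ := SubChoice.on Ext10.
HB.instance Definition _ := [SubChoice_isSubLmodule of Ext10 by <:].

End Ext.
End TModules.

(* Main.v *)
Require Import Defs.
From HB Require Import structures.
From mathcomp Require Import all_boot all_order all_algebra all_field.
From mathcomp Require Import boolp zify ring.

(* Row vectors over K{tau} of length m form the t-motive of the m-th tensor   *)
(* power of Carlitz: with t acting on the right they are K[t], where tau acts *)
(* as f |-> (t - theta)^m f^(1), f^(1) being the Frobenius twist of the       *)
(* coefficients. Using the superdiagonal of the n-th tensor power to clear    *)
(* all rows of delta(t) but the last one, Ext^1 becomes the quotient of K[t]  *)
(* by all (t - theta)^n f - (t - theta)^m f^(1). As n > m, the polynomials of *)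
(* degree less than n are a set of representatives. In the coordinates given  *)
(* by the powers of t - theta, multiplication by t is theta plus a shift, the *)
(* overflow c (t - theta)^n being replaced by c^q (t - theta)^m. Multiples of *)
(* (t - theta)^m are the sub-t-module isomorphic to the (n - m)-th tensor     *)
(* power and they are exactly the classes without constant term; on the       *)
(* quotient, tau does not occur.                                              *)

Set Implicit Arguments.
Unset Strict Implicit.
Unset Printing Implicit Defensive.

Import GRing.Theory.
Local Open Scope ring_scope.

(** A biderivation is determined by its value w at t, and every w occurs ([biderivation_eqX],
    [biderivation_ofX]), so Ext^1 consists of matrices w modulo those of the form U Et - Gt U. Rows
    are turned into polynomials by [row_poly], which is bijective. Modulo inner matrices all rows of
    w can be pushed into the last one, which gives [ext_poly]. What inner matrices contribute to it
    is just the boundary term X^n u - ptau u ([ext_poly_mulGt], [ext_poly_inner]).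

    As m < n, replacing X^n u by ptau u lowers degrees. The resulting normal form [red] has exactly
    these relations as kernel ([red_relation], [redP]), and by [coef_red_t] t acts on its n
    coefficients through [shift_mx]. That matrix is block triangular, with the (n - m)-th tensor
    power as submodule and a tau-free quotient: this gives the exact sequence ([shift_exact],
    [iterated_Ga_shift]). Finally [Ext10_carlitzP] recognizes Ext^1_0 as the multiples of X^m, the
    image of the submodule. *)

(** * Modules over twisted polynomials from a semilinear operator *)

Section SkewAction.
Variables (R : comNzRingType) (s : {rmorphism R -> R}).
Local Notation skew := (skew_poly s).
Local Notation sconst c := (skew_const s c).
Local Notation svar := (skew_var s).
Implicit Types (f g : skew) (c : R).

Lemma skew_const0 : sconst 0 = 0.
Proof. exact: polyC0. Qed.

Lemma skew_const1 : sconst 1 = 1.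
Proof. by []. Qed.

Lemma skew_constD : {morph skew_const s : c d / c + d}.
Proof. exact: polyCD. Qed.

Lemma skew_constM : {morph skew_const s : c d / c * d}.
Proof.
move=> c d; apply/polyP => i; rewrite [RHS]coef_skew_mul big_ord_recl big1.
  by rewrite addr0 subn0 !coefC /=; case: (i == 0)%N; rewrite ?mulr0.
by move=> j _; rewrite [X in X * _]coefC mul0r.
Qed.

Lemma skew_mulVarE f : f * svar = (f : {poly R}) * 'X :> {poly R}.
Proof.
apply/polyP => -[|k]; rewrite [LHS]coef_skew_mul_rev coefMX /=.
  by rewrite big_ord1 coefX mulr0.
rewrite !big_ord_recl /= !coefX !(iter_rmorph0, iter_rmorph1, rmorph0).
rewrite mulr0 add0r mulr1.
rewrite subn1 big1 ?addr0 // => i _.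
by rewrite coefX iter_rmorph0 mulr0.
Qed.

Lemma skew_ind (P : skew -> Prop) :
  P 0 -> (forall f c, P f -> P (f * svar + sconst c)) -> forall f, P f.
Proof.
move=> P0 PS; elim/poly_ind => // f c Pf.
by have := PS f c Pf; rewrite [_ + _](_ : _ = f * 'X + c%:P) // -skew_mulVarE.
Qed.

Variables (V : lmodType R) (rho : {additive V -> V}).
Hypothesis rhoZ : forall c v, rho (c *: v) = s c *: rho v.

Definition skew_act f (v : V) : V := \sum_(k < size f) f`_k *: iter k rho v.

Lemma skew_act_wide n f v :
  (size f <= n)%N -> skew_act f v = \sum_(k < n) f`_k *: iter k rho v.
Proof.
move=> le_n; rewrite /skew_act.
rewrite (big_ord_widen n (fun k => f`_k *: iter k rho v)) //.
rewrite big_mkcond; apply: eq_bigr => k _; case: ltnP => // le_k.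
by rewrite nth_default // scale0r.
Qed.

Lemma skew_act0l v : skew_act 0 v = 0.
Proof. by rewrite (@skew_act_wide 0) ?size_poly0 // big_ord0. Qed.

Lemma skew_actDl v : {morph skew_act^~ v : f g / f + g}.
Proof.
move=> f g; pose n := maxn (size f) (size g).
rewrite (@skew_act_wide n) ?size_polyD // (@skew_act_wide n f) ?leq_maxl //.
rewrite (@skew_act_wide n g) ?leq_maxr // -big_split /=.
by apply: eq_bigr => i _; rewrite coefD scalerDl.
Qed.

Lemma skew_act_const c v : skew_act (sconst c) v = c *: v.
Proof. by rewrite (@skew_act_wide 1) ?size_polyC_leq1 // big_ord1 coefC. Qed.

Lemma skew_actMvar f v : skew_act (f * svar) v = skew_act f (rho v).
Proof.
rewrite (@skew_act_wide (size f).+1) skew_mulVarE; last first.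
  by rewrite (leq_trans (size_polyMleq _ _)) // size_polyX addn2.
rewrite big_ord_recl coefMX scale0r add0r; apply: eq_bigr => k _.
by rewrite coefMX /= -iterSr.
Qed.

Lemma skew_act_var v : skew_act svar v = rho v.
Proof. by rewrite -[svar]mul1r skew_actMvar skew_act_const scale1r. Qed.

Lemma skew_actS f c v :
  skew_act (f * svar + sconst c) v = skew_act f (rho v) + c *: v.
Proof. by rewrite skew_actDl skew_actMvar skew_act_const. Qed.

Lemma skew_actDr f : {morph skew_act f : v w / v + w}.
Proof.
elim/skew_ind: f => [|f c IH] v w; first by rewrite !skew_act0l addr0.
by rewrite !skew_actS raddfD IH scalerDr addrACA.
Qed.

Lemma skew_act0r f : skew_act f 0 = 0.
Proof. by apply: (addrI (skew_act f 0)); rewrite -skew_actDr !addr0. Qed.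

Lemma skew_act_constM c f v : skew_act (sconst c * f) v = c *: skew_act f v.
Proof.
elim/skew_ind: f v => [|f d IH] v; first by rewrite mulr0 !skew_act0l scaler0.
by rewrite mulrDr mulrA -skew_constM !skew_actS IH scalerDr scalerA.
Qed.

Lemma skew_act_varM f v : skew_act (svar * f) v = rho (skew_act f v).
Proof.
elim/skew_ind: f v => [|f c IH] v; first by rewrite mulr0 !skew_act0l raddf0.
rewrite mulrDr mulrA skew_varM skew_actS skew_actDl !skew_actMvar IH.
by rewrite skew_act_const raddfD rhoZ.
Qed.

(** Semilinearity of [rho] matches the relation [skew_varM], which is what makes V a left module
    over the twisted polynomials. *)
Lemma skew_actM f g v : skew_act (f * g) v = skew_act f (skew_act g v).
Proof.
elim/skew_ind: f g v => [|f c IH] g v; first by rewrite mul0r !skew_act0l.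
by rewrite mulrDl -mulrA skew_actDl IH skew_act_constM skew_act_varM skew_actS.
Qed.

End SkewAction.

(** * The t-motive of a Carlitz tensor power *)

Section CarlitzPoly.
Variables (F : finFieldType) (K : fieldType) (emb : {rmorphism F -> K}).
Variable theta : K.
Local Notation Ktau := (twisted emb).
Local Notation frob := (qfrob emb).
Local Notation tconst c := (skew_const (qfrob emb) c).
Local Notation tau := (skew_var (qfrob emb)).
Local Notation P := {poly K}.
Implicit Types (p u : P) (c : K).

(* The variable 'X of {poly K} stands for t - theta, whose twist is          *)
(* t - theta ^ q = (t - theta) + (theta - theta ^ q).                        *)
Definition ptwist p : P := map_poly frob p \Po ('X + (theta - frob theta)%:P).

Fact ptwist_is_nmod_morphism : nmod_morphism ptwist.
Proof. by split=> [|p u]; rewrite /ptwist ?rmorph0 ?comp_poly0 ?rmorphD. Qed.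

HB.instance Definition _ := GRing.isNmodMorphism.Build P P ptwist
  ptwist_is_nmod_morphism.

Lemma ptwistM : {morph ptwist : p u / p * u}.
Proof. by move=> p u; rewrite /ptwist !rmorphM. Qed.

Lemma ptwistC c : ptwist c%:P = (frob c)%:P.
Proof. by rewrite /ptwist map_polyC comp_polyC. Qed.

Lemma ptwistX : ptwist 'X = 'X + (theta - frob theta)%:P.
Proof. by rewrite /ptwist map_polyX comp_polyX. Qed.

Lemma row_carlitz_mx n (i : 'I_n) (lt_i : (i.+1 < n)%N) :
  row i (carlitz_mx emb theta n)
  = tconst theta *: delta_mx 0 i + delta_mx 0 (Ordinal lt_i).
Proof.
apply/rowP => k; rewrite !mxE (ltn_eqF lt_i) addr0 mulr_natr eq_sym.
by rewrite -!val_eqE.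
Qed.

Lemma row_carlitz_mx_last n (n_gt0 : (0 < n)%N) (i : 'I_n) : i.+1 = n ->
  row i (carlitz_mx emb theta n)
  = tconst theta *: delta_mx 0 i + tau *: delta_mx 0 (Ordinal n_gt0).
Proof.
move=> in_; apply/rowP => k; rewrite !mxE in_ (ltn_eqF (ltn_ord k)) addr0 eqxx.
by rewrite !mulr_natr eq_sym -!val_eqE /=; congr (_ + _); case: eqP.
Qed.

Variable m : nat.

Definition ptau p : P := 'X^m * ptwist p.

Fact ptau_is_nmod_morphism : nmod_morphism ptau.
Proof. by split=> [|p u]; rewrite /ptau ?raddf0 ?mulr0 // raddfD mulrDr. Qed.

HB.instance Definition _ := GRing.isNmodMorphism.Build P P ptau
  ptau_is_nmod_morphism.

Lemma ptauZ c p : ptau (c *: p) = frob c *: ptau p.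
Proof. by rewrite /ptau -!mul_polyC ptwistM ptwistC mulrCA. Qed.

(** ['X + theta%:P] is t, which the twist fixes: the shift by theta - theta^q makes up for theta
    becoming theta^q. *)
Lemma ptau_t p : ptau (('X + theta%:P) * p) = ('X + theta%:P) * ptau p.
Proof.
by rewrite /ptau ptwistM raddfD /= ptwistC ptwistX polyCB addrA addrNK mulrCA.
Qed.

(** * Normal forms modulo the relations X^(N+1) u = ptau u *)

Section Reduction.
Variable N : nat.
Hypothesis le_mN : (m <= N)%N.

Definition red_step p : P := take_poly N.+1 p + ptau (drop_poly N.+1 p).

Fact red_step_is_nmod_morphism : nmod_morphism red_step.
Proof.
split=> [|p u]; rewrite /red_step.
  by rewrite take_poly0r drop_poly0r raddf0 addr0.
by rewrite take_polyD drop_polyD raddfD addrACA.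
Qed.

HB.instance Definition _ := GRing.isNmodMorphism.Build _ _ red_step
  red_step_is_nmod_morphism.

Lemma size_ptau p : (size (ptau p) <= m + size p)%N.
Proof.
rewrite (leq_trans (size_polyMleq _ _)) // size_polyXn /= leq_add2l.
by rewrite /ptwist size_comp_poly2 ?size_XaddC // size_map_poly.
Qed.

(** This is where m < n = N + 1 matters: N + 1 factors ['X] are traded for at most N. *)
Lemma size_red_step p : (size (red_step p) <= maxn N.+1 (size p).-1)%N.
Proof.
rewrite (leq_trans (size_polyD _ _)) // geq_max leq_max size_take_poly /=.
rewrite (leq_trans (size_ptau _)) // size_drop_poly.
by move: (size p) le_mN => k; lia.
Qed.

Lemma red_step_id p : (size p <= N.+1)%N -> red_step p = p.
Proof.
by move=> le_p; rewrite /red_step take_poly_id // drop_poly_eq0 // raddf0 addr0.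
Qed.

Lemma iter_red_step_id k p : (size p <= N.+1)%N -> iter k red_step p = p.
Proof. by move=> le_p; elim: k => //= k ->; apply: red_step_id. Qed.

(** A step shrinks any polynomial of size above [N.+1], so [size p] steps suffice. Further steps
    change nothing, hence [red] is additive although the number of steps depends on p. *)
Definition red p : P := iter (size p) red_step p.

Lemma size_red p : (size (red p) <= N.+1)%N.
Proof.
have szE k : (size (iter k red_step p) <= maxn N.+1 (size p - k))%N.
  elim: k => [|k IH]; first by rewrite subn0 leq_maxr.
  rewrite (leq_trans (size_red_step _)) //= subnS.
  by move: (size (iter k red_step p)) (size p) IH => a b; lia.
by have := szE (size p); rewrite subnn maxn0.
Qed.

Lemma red_wide k p : (size p <= k)%N -> red p = iter k red_step p.
Proof.
by move=> le_p; rewrite -(subnK le_p) iterD iter_red_step_id // size_red.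
Qed.

Lemma iter_red_stepD k : {morph iter k red_step : p u / p + u}.
Proof. by move=> p u; elim: k => //= k ->; rewrite raddfD. Qed.

Fact red_is_nmod_morphism : nmod_morphism red.
Proof.
split=> [|p u]; first by rewrite /red size_poly0.
pose k := maxn (size p) (size u).
rewrite (@red_wide k) ?size_polyD // (@red_wide k p) ?leq_maxl //.
by rewrite (@red_wide k u) ?leq_maxr // iter_red_stepD.
Qed.

HB.instance Definition _ := GRing.isNmodMorphism.Build _ _ red
  red_is_nmod_morphism.

Lemma red_id p : (size p <= N.+1)%N -> red p = p.
Proof. exact: iter_red_step_id. Qed.

Lemma red_red_step p : red (red_step p) = red p.
Proof.
pose k := maxn (size p) (size (red_step p)).
rewrite (@red_wide k) ?leq_maxr // -iterSr.
by rewrite -red_wide // (leq_trans _ (leqnSn k)) // leq_maxl.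
Qed.

Lemma red_relation u : red ('X^(N.+1) * u - ptau u) = 0.
Proof.
rewrite raddfB /= -red_red_step /red_step [_ * u]mulrC.
by rewrite take_polyMXn_0 drop_polyMXn_id add0r subrr.
Qed.

Lemma red_stepP p : exists u, p - red_step p = 'X^(N.+1) * u - ptau u.
Proof.
exists (drop_poly N.+1 p).
rewrite -{1}(poly_take_drop N.+1 p) /red_step opprD addrACA subrr add0r.
by rewrite mulrC.
Qed.

(** Together with [red_relation], this identifies the kernel of [red] with the set of relations. *)
Lemma redP p : exists u, p - red p = 'X^(N.+1) * u - ptau u.
Proof.
rewrite /red; elim: (size p) => [|k [u uE]] /=.
  by exists 0; rewrite raddf0 mulr0 !subrr.
have [v vE] := red_stepP (iter k red_step p); exists (u + v).
rewrite -[p - _](subrKA (iter k red_step p)) uE vE [ptau (u + v)]raddfD /=.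
by ring.
Qed.

Lemma red_t p : red (('X + theta%:P) * p) = red (('X + theta%:P) * red p).
Proof.
have [u pE] := redP p; apply/eqP.
rewrite -subr_eq0 -raddfB /= -mulrBr pE mulrBr.
by rewrite -ptau_t mulrCA red_relation.
Qed.

(** Multiplying a reduced polynomial by t overflows only through its top coefficient c, and c
    X^(N+1) becomes c^q X^m. Up to reversing coordinates, this is the action of [shift_mx]. *)
Lemma coef_red_t p k : (k <= N)%N ->
  (red (('X + theta%:P) * p))`_k
  = theta * (red p)`_k + (if k == 0 then 0 else (red p)`_k.-1)
    + (if k == m then frob (red p)`_N else 0).
Proof.
move=> le_k; rewrite red_t; set r := red p.
have sz_r : (size r <= N.+1)%N := size_red p.
rewrite mulrDl raddfD /= [X in _ + X]red_id; last first.
  by rewrite mul_polyC (leq_trans (size_scale_leq _ _)).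
rewrite -red_red_step (_ : red_step _ = take_poly N.+1 ('X * r)
    + frob r`_N *: 'X^m); last first.
  congr (_ + _); rewrite (_ : drop_poly _ _ = (r`_N)%:P).
    by rewrite /ptau ptwistC mulrC mul_polyC.
  apply/polyP => -[|i]; rewrite coef_drop_poly coefXM coefC //=.
  by rewrite nth_default // (leq_trans sz_r) // leq_addl.
rewrite red_id; last first.
  rewrite (leq_trans (size_polyD _ _)) // geq_max size_take_poly /=.
  by rewrite (leq_trans (size_scale_leq _ _)) // size_polyXn ltnS.
rewrite !coefD coef_take_poly coefXM coefZ coefXn coefCM ltnS le_k addrC addrA.
by congr (_ + _); case: eqP; rewrite ?mulr1 ?mulr0.
Qed.

Lemma red_dvdXm p : 'X^m %| p -> 'X^m %| red p.
Proof.
move=> dvd_p; have [u pE] := redP p.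
have -> : red p = p - ('X^(N.+1) * u - ptau u) by rewrite -pE opprB addrC subrK.
rewrite !dvdp_sub ?dvdp_mulIl // dvdp_mulr // dvdp_exp2l //; exact: leqW.
Qed.

End Reduction.

(** * Row vectors over K{tau} as polynomials in t - theta *)

Local Notation act := (skew_act [the {additive P -> P} of ptau]).
Let actE := (skew_actM ptauZ).

Lemma act_t (x : Ktau) p :
  act x (('X + theta%:P) * p) = ('X + theta%:P) * act x p.
Proof.
elim/skew_ind: x p => [|x c IH] p; first by rewrite !skew_act0l mulr0.
by rewrite !skew_actS /= ptau_t IH mulrDr -!mul_polyC mulrCA.
Qed.

Definition row_poly (v : 'rV[Ktau]_m) : P := \sum_j act (v 0 j) 'X^j.

Lemma row_polyD : {morph row_poly : v w / v + w}.
Proof.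
move=> v w; rewrite /row_poly -big_split; apply: eq_bigr => j _.
by rewrite mxE skew_actDl.
Qed.

Lemma row_poly0 : row_poly 0 = 0.
Proof. by rewrite /row_poly big1 // => j _; rewrite mxE skew_act0l. Qed.

HB.instance Definition _ := GRing.isNmodMorphism.Build 'rV[Ktau]_m P row_poly
  (conj row_poly0 row_polyD).

Lemma row_polyZ x v : row_poly (x *: v) = act x (row_poly v).
Proof.
rewrite /row_poly (big_morph _ (skew_actDr _ _) (skew_act0r _ _)).
by apply: eq_bigr => j _; rewrite mxE actE.
Qed.

Hypothesis m_gt0 : (0 < m)%N.
Local Notation Et := (carlitz_mx emb theta m).

Lemma row_poly_delta (j : 'I_m) : row_poly (delta_mx 0 j) = 'X^j.
Proof.
rewrite /row_poly (bigD1 j) //= mxE !eqxx skew_act_const scale1r.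
rewrite big1 ?addr0 // => k /negPf ne_kj.
by rewrite mxE ne_kj andbF skew_act0l.
Qed.

(** The superdiagonal raises the power of t - theta by one. In the last row, tau e_0 = (t - theta)^m
    continues the pattern, which explains the factor ['X^m] in [ptau]. *)
Lemma row_carlitz (j : 'I_m) :
  row_poly (row j Et) = ('X + theta%:P) * 'X^j.
Proof.
have [lt_j|le_m] := ltnP j.+1 m.
  rewrite (row_carlitz_mx lt_j) raddfD /= row_polyZ !row_poly_delta.
  by rewrite skew_act_const exprS mulrDl mul_polyC addrC.
have jm : j.+1 = m by apply/eqP; rewrite eqn_leq le_m ltn_ord.
rewrite (row_carlitz_mx_last m_gt0 jm) raddfD /= !row_polyZ !row_poly_delta.
rewrite skew_act_const skew_act_var /= mulrDl mul_polyC -exprS addrC jm.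
by rewrite /ptau expr0 ptwistC /qfrob expr1n mulr1.
Qed.

Lemma row_poly_mulEt v : row_poly (v *m Et) = ('X + theta%:P) * row_poly v.
Proof.
rewrite mulmx_sum_row raddf_sum [in RHS]/row_poly mulr_sumr.
apply: eq_bigr => j _ /=.
by rewrite row_polyZ row_carlitz act_t.
Qed.

Definition row_shift (v : 'rV[Ktau]_m) := v *m Et - tconst theta *: v.

Lemma row_poly_shift v : row_poly (row_shift v) = 'X * row_poly v.
Proof.
rewrite raddfB /= row_poly_mulEt row_polyZ skew_act_const mulrDl.
by rewrite mul_polyC addrK.
Qed.

Lemma row_poly_surj p : exists v, row_poly v = p.
Proof.
elim/poly_ind: p => [|p c [v <-]]; first by exists 0; apply: row_poly0.
exists (row_shift v + tconst c *: delta_mx 0 (Ordinal m_gt0)).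
rewrite raddfD /= row_poly_shift row_polyZ row_poly_delta skew_act_const.
by rewrite expr0 alg_polyC mulrC.
Qed.

Fact row_shift_is_nmod_morphism : nmod_morphism row_shift.
Proof.
split=> [|v w]; rewrite /row_shift ?mul0mx ?scaler0 ?subrr //.
by rewrite mulmxDl scalerDr opprD addrACA.
Qed.

HB.instance Definition _ := GRing.isNmodMorphism.Build _ _ row_shift
  row_shift_is_nmod_morphism.

Lemma row_shiftZ c v : row_shift (tconst c *: v) = tconst c *: row_shift v.
Proof.
by rewrite /row_shift -scalemxAl scalerBr !scalerA -!skew_constM mulrC.
Qed.

(** Moving tau past t - theta costs the same theta - theta^q as in [ptwistX]. *)
Lemma row_shift_tau v :
  tau *: row_shift v
  = row_shift (tau *: v) + tconst (theta - frob theta) *: (tau *: v).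
Proof.
rewrite /row_shift -scalemxAl scalerBr !scalerA skew_varM skew_constD.
by rewrite [tconst (- _)]polyCN mulrBl scalerBl addrA subrK.
Qed.

Let e0 : 'rV[Ktau]_m := delta_mx 0 (Ordinal m_gt0).

(** The inverse of [row_poly]: p evaluated at the operator t - theta, applied to e_0. *)
Definition poly_row p : 'rV[Ktau]_m :=
  \sum_(i < size p) tconst p`_i *: iter i row_shift e0.

Lemma poly_row_wide n p : (size p <= n)%N ->
  poly_row p = \sum_(i < n) tconst p`_i *: iter i row_shift e0.
Proof.
move=> le_n; rewrite /poly_row.
rewrite (big_ord_widen n (fun i => tconst p`_i *: iter i row_shift e0)) //.
rewrite big_mkcond; apply: eq_bigr => i _; case: ltnP => // le_i.
by rewrite nth_default // skew_const0 scale0r.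
Qed.

Fact poly_row_is_nmod_morphism : nmod_morphism poly_row.
Proof.
split=> [|p u]; first by rewrite (@poly_row_wide 0) ?size_poly0 // big_ord0.
pose n := maxn (size p) (size u).
rewrite (@poly_row_wide n) ?size_polyD // (@poly_row_wide n p) ?leq_maxl //.
rewrite (@poly_row_wide n u) ?leq_maxr // -big_split /=.
by apply: eq_bigr => i _; rewrite coefD skew_constD scalerDl.
Qed.

HB.instance Definition _ := GRing.isNmodMorphism.Build _ _ poly_row
  poly_row_is_nmod_morphism.

Lemma poly_rowMX p : poly_row ('X * p) = row_shift (poly_row p).
Proof.
rewrite mulrC (@poly_row_wide (size p).+1); last first.
  by rewrite (leq_trans (size_polyMleq _ _)) // size_polyX addn2.
rewrite big_ord_recl coefMX /= skew_const0 scale0r add0r raddf_sum.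
by apply: eq_bigr => i _; rewrite coefMX /= row_shiftZ.
Qed.

Lemma poly_rowZ c p : poly_row (c *: p) = tconst c *: poly_row p.
Proof.
rewrite (@poly_row_wide (size p)) ?size_scale_leq // scaler_sumr.
by apply: eq_bigr => i _; rewrite coefZ skew_constM scalerA.
Qed.

Lemma poly_row1 : poly_row 1 = e0.
Proof.
by rewrite /poly_row size_poly1 big_ord1 coef1 eqxx skew_const1 scale1r.
Qed.

Lemma row_shift_delta (j : 'I_m) (lt_j : (j.+1 < m)%N) :
  row_shift (delta_mx 0 j) = delta_mx 0 (Ordinal lt_j).
Proof.
by rewrite /row_shift -rowE (row_carlitz_mx lt_j) addrC addKr.
Qed.

Lemma poly_rowXn (j : 'I_m) : poly_row 'X^j = delta_mx 0 j.
Proof.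
case: j => j; elim: j => [|j IH] lt_j /=.
  by rewrite expr0 poly_row1; congr delta_mx; apply/val_inj.
by rewrite exprS poly_rowMX (IH (ltnW lt_j)) row_shift_delta.
Qed.

Lemma poly_rowXm : poly_row 'X^m = tau *: e0.
Proof.
have lt_m : (m.-1 < m)%N by rewrite prednK.
have -> : 'X^m = 'X * 'X^(Ordinal lt_m) :> P by rewrite -exprS /= prednK.
rewrite poly_rowMX poly_rowXn.
rewrite /row_shift -rowE (row_carlitz_mx_last m_gt0) /= ?prednK //.
by rewrite addrC addKr.
Qed.

Lemma poly_row_ptau p : poly_row (ptau p) = tau *: poly_row p.
Proof.
elim/poly_ind: p => [|p c IH]; first by rewrite !raddf0.
rewrite !raddfD /= mulrC; congr (_ + _); last first.
  rewrite -alg_polyC ptauZ !poly_rowZ /ptau ptwistC /qfrob expr1n mulr1.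
  by rewrite poly_rowXm poly_row1 !scalerA skew_varM.
rewrite poly_rowMX row_shift_tau -IH -poly_rowMX -poly_rowZ -raddfD /=.
by rewrite /ptau ptwistM ptwistX mulrCA mulrDl -mul_polyC.
Qed.

Lemma poly_row_act (x : Ktau) p : poly_row (act x p) = x *: poly_row p.
Proof.
elim/skew_ind: x p => [|x c IH] p; first by rewrite skew_act0l raddf0 scale0r.
by rewrite skew_actS raddfD /= IH poly_row_ptau poly_rowZ scalerA scalerDl.
Qed.

Lemma row_polyK : cancel row_poly poly_row.
Proof.
move=> v; rewrite /row_poly raddf_sum [RHS]row_sum_delta.
apply: eq_bigr => j _ /=.
by rewrite poly_row_act poly_rowXn.
Qed.

(** * From the value of a biderivation at t to one polynomial *)

Section ExtPoly.
Variable N : nat.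
Local Notation Gt := (carlitz_mx emb theta N.+1).

(** For i < N, row i of U Et - Gt U is (t - theta) U_i - U_(i+1). Modulo inner matrices, row i can
    thus be moved to row i + 1 at the cost of a factor t - theta; the weights carry all rows to the
    last one. *)
Definition ext_poly (w : 'M[Ktau]_(N.+1, m)) : P :=
  \sum_(i < N.+1) 'X^(N - i) * row_poly (row i w).

Fact ext_poly_is_nmod_morphism : nmod_morphism ext_poly.
Proof.
split=> [|v w]; rewrite /ext_poly.
  by rewrite big1 // => i _; rewrite row0 raddf0 mulr0.
by rewrite -big_split; apply: eq_bigr => i _; rewrite !raddfD mulrDr.
Qed.

HB.instance Definition _ := GRing.isNmodMorphism.Build _ _ ext_poly
  ext_poly_is_nmod_morphism.

Lemma ext_poly_mulEt w : ext_poly (w *m Et) = ('X + theta%:P) * ext_poly w.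
Proof.
rewrite /ext_poly mulr_sumr; apply: eq_bigr => i _.
by rewrite row_mul row_poly_mulEt mulrCA.
Qed.

Lemma row_mulGt (w : 'M[Ktau]_(N.+1, m)) (i : 'I_N) :
  row (widen_ord (leqnSn N) i) (Gt *m w)
  = tconst theta *: row (widen_ord (leqnSn N) i) w + row (lift ord0 i) w.
Proof.
have lt_i : ((widen_ord (leqnSn N) i).+1 < N.+1)%N by rewrite ltnS /=.
rewrite row_mul (row_carlitz_mx lt_i) mulmxDl -scalemxAl -!rowE.
by congr (_ + row _ _); apply/val_inj.
Qed.

Lemma row_mulGt_max (w : 'M[Ktau]_(N.+1, m)) :
  row ord_max (Gt *m w) = tconst theta *: row ord_max w + tau *: row ord0 w.
Proof.
rewrite row_mul (row_carlitz_mx_last (ltn0Sn N)) // mulmxDl -!scalemxAl -!rowE.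
by congr (_ + _ *: row _ _); apply/val_inj.
Qed.

(** The superdiagonal of Gt reproduces multiplication by t - theta except on row 0, whose term
    X^(N+1) is missing; the corner entry tau returns that row through [ptau] instead. *)
Lemma ext_poly_mulGt w : ext_poly (Gt *m w)
  = ('X + theta%:P) * ext_poly w
    - ('X^(N.+1) * row_poly (row ord0 w) - ptau (row_poly (row ord0 w))).
Proof.
have XE : 'X * ext_poly w = 'X^(N.+1) * row_poly (row ord0 w)
    + \sum_(i < N) 'X^(N - i) * row_poly (row (lift ord0 i) w).
  rewrite /ext_poly big_ord_recl mulrDr mulrA -exprS subn0.
  congr (_ + _); rewrite mulr_sumr; apply: eq_bigr => i _.
  by rewrite mulrA -exprS /= /bump /= add1n subnSK.
suff -> : ext_poly (Gt *m w) = theta%:P * ext_poly w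
    + (\sum_(i < N) 'X^(N - i) * row_poly (row (lift ord0 i) w)
       + ptau (row_poly (row ord0 w))) by rewrite mulrDl XE; ring.
rewrite /ext_poly !big_ord_recr /= row_mulGt_max subnn expr0 !mul1r.
rewrite raddfD /= !row_polyZ skew_act_const skew_act_var -mul_polyC.
rewrite (eq_bigr (fun i : 'I_N =>
    theta%:P * ('X^(N - i) * row_poly (row (widen_ord (leqnSn N) i) w))
    + 'X^(N - i) * row_poly (row (lift ord0 i) w))) => [|i _].
  by rewrite big_split -mulr_sumr /=; ring.
rewrite row_mulGt raddfD /= row_polyZ skew_act_const.
by rewrite mulrDr -mul_polyC mulrCA.
Qed.

Lemma ext_poly_surj p : exists w, ext_poly w = p.
Proof.
have [v vp] := row_poly_surj p.
exists (\matrix_i (if i == ord_max then v else 0)).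
rewrite /ext_poly (bigD1 ord_max) //= big1 ?addr0 => [|i /negPf ne_i].
  by rewrite rowK eqxx vp subnn mul1r.
by rewrite rowK ne_i raddf0 mulr0.
Qed.

Lemma ext_poly_inner w u : ext_poly w = 'X^(N.+1) * u - ptau u ->
  exists U : 'M_(N.+1, m), w = U *m Et - Gt *m U.
Proof.
have [v0 <-] := row_poly_surj u => wE.
(* The recursion is forced by making all rows but the last of w - (U Et - Gt U) vanish. Row 0 of U
   remains free and is given the polynomial u. *)
pose V := fix V k :=
  if k is k'.+1 then row_shift (V k') - row (inord k') w else v0.
pose U := \matrix_(i < N.+1) V i; exists U.
apply/eqP; rewrite -subr_eq0; set w' := w - _; apply/eqP.
have V0 : row ord0 U = v0 by rewrite rowK.
have w'0 (i : 'I_N) : row (widen_ord (leqnSn N) i) w' = 0.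
  rewrite !raddfB /= row_mul row_mulGt !rowK /= add0n opprK /row_shift.
  rewrite (_ : inord i = widen_ord (leqnSn N) i); last first.
    by apply/val_inj; rewrite /= inordK // ltnS ltnW.
  by rewrite [in X in _ + (_ + X)]addrA [_ *: _ + _]addrC subrK addKr subrr.
have : ext_poly w' = 0.
  by rewrite !raddfB /= ext_poly_mulEt ext_poly_mulGt V0 wE; ring.
rewrite /ext_poly big_ord_recr /= big1 ?add0r => [|i _]; last first.
  by rewrite w'0 raddf0 mulr0.
(* Only the last row is left, with weight 1, and [row_poly] is injective. *)
rewrite subnn mul1r => /(congr1 poly_row); rewrite row_polyK raddf0 => w'max.
apply/row_matrixP => i; rewrite row0; case: (unliftP ord_max i) => [j ->|->//].
rewrite -(w'0 j); congr row; apply/val_inj.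
by rewrite /= /bump leqNgt ltn_ord.
Qed.

End ExtPoly.
End CarlitzPoly.

(** * Generalities on linear maps, bijections and nilpotent matrices *)

Lemma linear_of (R : nzRingType) (U V : lmodType R) (f : U -> V) :
  linear f -> exists g : {linear U -> V}, g =1 f.
Proof.
move=> f_lin; pose M := GRing.isLinear.Build R U V *:%R f f_lin.
by pose g : {linear U -> V} := HB.pack f M; exists g.
Qed.

Lemma inj_surj_bij (A B : Type) (f : A -> B) :
  injective f -> (forall y, exists x, f x = y) -> bijective f.
Proof.
move=> f_inj /boolp.choice[g gK]; exists g => // x.
exact/f_inj/gK.
Qed.

Lemma strict_upper_nilpotent (K : fieldType) d (A : 'M[K]_d) :
  (forall i j : 'I_d, (j <= i)%N -> A i j = 0) -> exists k, A ^+ k = 0.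
Proof.
move=> A0; have powA k (i j : 'I_d) : (j < i + k)%N -> (A ^+ k) i j = 0.
  elim: k i j => [|k IH] i j lt_j.
    by rewrite expr0 mxE -val_eqE /= gtn_eqF // -(addn0 i).
  rewrite exprS mxE big1 // => l _; have [le_l|lt_i] := leqP l i.
    by rewrite A0 ?mul0r.
  by rewrite IH ?mulr0 // (leq_trans lt_j) // addnS -addSn leq_add2r.
exists d; apply/matrixP => i j; rewrite powA ?mxE //.
by rewrite (leq_trans (ltn_ord j)) // leq_addl.
Qed.

(** * Biderivations and Ext^1 through values at t *)

Section TModuleTheory.
Variables (F : finFieldType) (K : fieldType) (emb : {rmorphism F -> K}).
Variable theta : K.
Local Notation Ktau := (twisted emb).
Local Notation frob := (qfrob emb).
Local Notation tconst c := (skew_const (qfrob emb) c).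
Local Notation tau := (skew_var (qfrob emb)).
Local Notation tmodule := (tmodule emb theta).

Lemma tact_const d (E : tmodule d) c : E c%:P = tconst (emb c) *: 1%:M.
Proof. by rewrite -alg_polyC tact_linear rmorph1. Qed.

Lemma tmorphism_eqX d e (E : tmodule d) (G : tmodule e) (M : 'M[Ktau]_(e, d)) :
  M *m E 'X = G 'X *m M -> forall a, M *m E a = G a *m M.
Proof.
move=> MX; elim/poly_ind => [|a c IH]; first by rewrite !rmorph0 mulmx0 mul0mx.
rewrite !rmorphD /= mulmxDr mulmxDl !tactM mulmxA IH -!mulmxA MX.
congr (_ + _).
by rewrite !tact_const tconst_scalemxAr mulmx1 -scalemxAl mul1mx.
Qed.

Section Biderivations.
Variables (d e : nat) (E : tmodule d) (G : tmodule e).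

(** The product rule forces a biderivation to vanish on constants and then determines it from its
    value at t. *)
Lemma biderivation_eqX (x y : {poly F} -> 'M[Ktau]_(e, d)) :
  is_biderivation E G x -> is_biderivation E G y -> x 'X = y 'X -> x =1 y.
Proof.
have const0 z c : is_biderivation E G z -> z c%:P = 0.
  move=> [zL zM].
  have z1 : z 1 = 0.
    apply: (addrI (z 1)).
    by rewrite addr0 -{3}[1]mulr1 zM !rmorph1 mul1mx mulmx1.
  have z0 : z 0 = 0.
    by have := zM 0 0; rewrite mulr0 !rmorph0 mul0mx mulmx0 addr0.
  by rewrite -alg_polyC -[_ *: 1]addr0 zL z1 z0 scaler0 addr0.
move=> xB yB xyX; have [xL xM] := xB; have [yL yM] := yB.
elim/poly_ind => [|a c IH]; first by rewrite -polyC0 !const0.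
by rewrite -[a * 'X]scale1r xL yL !const0 // !addr0 xM yM IH xyX.
Qed.

Lemma inner_biderivation (U : 'M[Ktau]_(e, d)) :
  is_biderivation E G (fun a => U *m E a - G a *m U).
Proof.
split=> [c a b|a b].
  rewrite !rmorphD /= !tact_linear mulmxDr mulmxDl tconst_scalemxAr -scalemxAl.
  by rewrite scalerBr opprD addrACA.
by rewrite !tactM mulmxBr mulmxBl !mulmxA [RHS]addrC subrKA.
Qed.

(** Evaluation at the block matrix T of the desired extension is a ring homomorphism; block
    multiplication is the product rule for its lower left block. *)
Lemma biderivation_ofX (w : 'M[Ktau]_(e, d)) :
  exists delta : biderivation E G, delta 'X = w.
Proof.
pose T := block_mx (E 'X) 0 w (G 'X).
pose D a := dlsubmx (eval_mx T a).
have TE a : eval_mx T a = block_mx (E a) 0 (D a) (G a).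
  suff [D' TD'] : exists D', eval_mx T a = block_mx (E a) 0 D' (G a).
    by rewrite /D TD' block_mxKdl.
  elim/poly_ind: a => [|a c [D' IH]].
    by exists 0; rewrite !rmorph0 block_mx_const.
  exists (D' *m E 'X + G a *m w).
  rewrite !rmorphD /= eval_mxMX IH !tactM !tact_const.
  rewrite [_ * T]mulmx_block !mul0mx !mulmx0 !addr0 add0r.
  rewrite -alg_polyC eval_mxZ eval_mx1.
  rewrite [1 in X in _ + X](scalar_mx_block d e 1) scale_block_mx.
  by rewrite add_block_mx !scaler0 !addr0.
have D_bider : D \in biderivation_pred E G.
  apply/asboolP; split=> [c a b|a b]; rewrite /D.
    by rewrite rmorphD /= eval_mxZ !TE scale_block_mx add_block_mx !block_mxKdl.
  by rewrite rmorphM /= !TE [_ * _]mulmx_block !block_mxKdl addrC.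
by exists (Biderivation D_bider); rewrite /= /D eval_mxX block_mxKdl.
Qed.

Lemma bider_subE (x y : biderivation E G) a : (x - y) a = x a - y a.
Proof. by []. Qed.

Lemma bider_linearE b (x y : biderivation E G) a :
  (b *: x + y) a = G b *m x a + y a.
Proof. by []. Qed.

Local Notation inner := (inner (E := E) (G := G)).

Lemma innerP (delta : biderivation E G) :
  reflect (exists U, delta 'X = U *m E 'X - G 'X *m U) (delta \in inner).
Proof.
apply: (iffP idP) => [/asboolP[U dU]|[U dU]]; first by exists U.
have /asboolP delta_bider := biderP delta; apply/asboolP; exists U.
exact: biderivation_eqX delta_bider (inner_biderivation U) dU.
Qed.

(** Computes Ext^1 from a surjection on values at t whose kernel is the inner ones. Linearity over
    F[t] need only be checked for t and for constants. *)
Lemma Ext1_iso (Y : lmodType {poly F}) (pi : {additive 'M[Ktau]_(e, d) -> Y}) :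
    (forall w, pi (G 'X *m w) = 'X *: pi w) ->
    (forall c w, pi (tconst (emb c) *: w) = c%:P *: pi w) ->
    (forall y, exists w, pi w = y) ->
    (forall w, pi w = 0 <-> exists U, w = U *m E 'X - G 'X *m U) ->
  exists phi : {linear Ext1 E G -> Y},
    bijective phi /\ forall delta, phi (ext_class delta) = pi (delta 'X).
Proof.
move=> piX piC pi_surj pi_ker.
have piG a w : pi (G a *m w) = a *: pi w.
  elim/poly_ind: a w => [|a c IH] w.
    by rewrite rmorph0 mul0mx raddf0 scale0r.
  rewrite rmorphD /= mulmxDl tactM -mulmxA raddfD /= IH piX scalerA scalerDl.
  by rewrite tact_const -scalemxAl mul1mx piC.
pose phi0 (x : Ext1 E G) : Y := pi (repr (x : Quotient.quot inner) 'X).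
have phi0E delta : phi0 (ext_class delta) = pi (delta 'X).
  rewrite /phi0; set delta' := repr _.
  have /innerP/pi_ker : delta' - delta \in inner.
    by apply/ext_class_eq; rewrite /ext_class reprK.
  by rewrite bider_subE raddfB => /eqP; rewrite subr_eq0 => /eqP.
have [a x y|phi phiE] := @linear_of _ _ _ phi0 _.
  have [u ->] := ext_class_surj x; have [v ->] := ext_class_surj y.
  rewrite [_ *: ext_class _]Ext1_scaleE -ext_classD !phi0E bider_linearE.
  by rewrite raddfD /= piG.
exists phi; split=> [|delta]; last by rewrite phiE.
apply: inj_surj_bij => [x y|y].
  have [u ->] := ext_class_surj x; have [v ->] := ext_class_surj y.
  rewrite !phiE !phi0E => uv; apply/ext_class_eq/innerP/pi_ker.
  by rewrite bider_subE raddfB uv subrr.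
have [w <-] := pi_surj y; have [delta <-] := biderivation_ofX w.
by exists (ext_class delta); rewrite phiE.
Qed.

End Biderivations.

(** * Points of t-modules and exact sequences *)

Section Points.
Variable R : comAlgType K.

Lemma tau_mulmx_const d c (v : 'cV[R]_d) i :
  tau_mulmx (tconst c)%:M v i 0 = c *: v i 0.
Proof.
rewrite mxE (bigD1 i) //= mxE eqxx tau_eval_const.
by rewrite big1 ?addr0 // => k /negPf ne_k; rewrite mxE eq_sym ne_k tau_eval0l.
Qed.

Lemma tau_mulmx0 d e (v : 'cV[R]_d) : tau_mulmx (0 : 'M[Ktau]_(e, d)) v = 0.
Proof.
by apply/matrixP => i j; rewrite !mxE big1 // => k _; rewrite mxE tau_eval0l.
Qed.

Lemma tau_mulmx_col d e1 e2 (M : 'M[Ktau]_(e1, d)) (M' : 'M[Ktau]_(e2, d))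
    (v : 'cV[R]_d) :
  tau_mulmx (col_mx M M') v = col_mx (tau_mulmx M v) (tau_mulmx M' v).
Proof.
apply/colP => i; rewrite -[i]splitK; case: (split i) => k /=.
  by rewrite !(mxE, col_mxEu); apply: eq_bigr => j _; rewrite col_mxEu.
by rewrite !(mxE, col_mxEd); apply: eq_bigr => j _; rewrite col_mxEd.
Qed.

Lemma tau_mulmx_row d1 d2 e (M : 'M[Ktau]_(e, d1)) (M' : 'M[Ktau]_(e, d2))
    (v : 'cV[R]_(d1 + d2)) :
  tau_mulmx (row_mx M M') v = tau_mulmx M (usubmx v) + tau_mulmx M' (dsubmx v).
Proof.
apply/colP => i; rewrite !mxE big_split_ord; congr (_ + _).
  by apply: eq_bigr => j _; rewrite row_mxEl mxE.
by apply: eq_bigr => j _; rewrite row_mxEr mxE.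
Qed.

Lemma tau_eval_var (x : R) : tau_eval (tau : Ktau) x = x ^+ #|F|.
Proof.
rewrite (@tau_eval_wide _ _ _ _ 2) ?size_polyX // !big_ord_recl big_ord0.
by rewrite !coefX /= scale0r add0r scale1r addr0 expn1.
Qed.

Lemma scale_points_const d (E : tmodule d) c (v : points E R) i :
  (c%:P *: v : 'cV[R]_d) i 0 = emb c *: (v : 'cV[R]_d) i 0.
Proof.
rewrite -[c%:P *: v]/(tau_mulmx (E c%:P) v) tact_const.
rewrite -[_ *: 1%:M]mul_scalar_mx.
by rewrite mulmx1 tau_mulmx_const.
Qed.

Lemma tmor_points_linear d e (E : tmodule d) (G : tmodule e)
  (f : tmorphism E G) : linear (@tmor_points _ _ _ _ _ _ _ _ f R).
Proof.
move=> a v w; rewrite /tmor_points tau_mulmxDr; congr (_ + _).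
by rewrite [LHS]tau_mulmxA tmorP -tau_mulmxA.
Qed.

End Points.

(** On underlying groups the sequence is the split one, hence exact on R-points for every R. *)
Lemma short_exact_block d e (A : tmodule d) (B : tmodule (d + e))
    (C : tmodule e) (f : tmorphism A B) (g : tmorphism B C) :
  tmor_mx f = col_mx 1%:M 0 -> tmor_mx g = row_mx 0 1%:M -> short_exact f g.
Proof.
move=> fE gE R.
have fR v : @tmor_points _ _ _ _ _ _ _ _ f R v = col_mx v 0.
  by rewrite /tmor_points fE tau_mulmx_col tau_mulmx1 tau_mulmx0.
have gR v : @tmor_points _ _ _ _ _ _ _ _ g R v = dsubmx v.
  by rewrite /tmor_points gE tau_mulmx_row tau_mulmx1 tau_mulmx0 add0r.
split=> [v w|v|w].
- by rewrite !fR => /eq_col_mx[].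
- rewrite gR; split=> [v0|[w ->]]; last by rewrite fR col_mxKd.
  by exists (usubmx v); rewrite fR -[v in LHS]vsubmxK v0.
by exists (col_mx 0 w); rewrite gR col_mxKd.
Qed.

(* For r = d this is the t-action on the d-th tensor power of Carlitz; for   *)
(* r = 0 it has no tau-term.                                                 *)
Definition shift_mx d r : 'M[Ktau]_d :=
  (tconst theta)%:M
  + \matrix_(i, j) (val j == (val i).+1)%:R
  + \matrix_(i, j) (if ((val i).+1 == r) && (val j == 0)%N then tau else 0).

Lemma shift_mx_nilpotent d r :
  exists k, (lie (shift_mx d r) - theta%:M) ^+ k = 0.
Proof.
apply: strict_upper_nilpotent => i j le_ji; rewrite !mxE !coefD.
rewrite [X in _ + X - _](_ : _ = 0); last by case: ifP; rewrite ?coefX ?coef0.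
rewrite (ltn_eqF (_ : j < i.+1)%N) ?ltnS // coef0 !addr0.
by case: (i == j); rewrite ?mulr1n ?mulr0n ?coefC ?coef0 subrr.
Qed.

(** As r <= d, any entry tau lies in the upper left block and the quotient is tau-free. *)
Lemma shift_mx_block d e r : (r <= d)%N ->
  shift_mx (d + e) r
  = block_mx (shift_mx d r)
      (\matrix_(i, j) (((val i).+1 == d) && (val j == 0)%N)%:R)
      0 (shift_mx e 0).
Proof.
move=> le_rd; rewrite -[LHS]submxK; congr block_mx; apply/matrixP => i j.
- by rewrite !mxE eq_lshift.
- rewrite !mxE eq_lrshift /= add0r addn_eq0.
  rewrite (gtn_eqF (leq_ltn_trans _ (ltn_ord i))) //.
  rewrite andbF addr0; congr (_%:R); have := ltn_ord i; lia.
- rewrite !mxE eq_rlshift /= add0r (_ : (_ == r) = false) ?addr0; last lia.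
  by rewrite (_ : (_ == _) = false) //; have := ltn_ord j; lia.
rewrite !mxE eq_rshift /= -addnS eqn_add2l (_ : (_ == r) = false) //; lia.
Qed.

Lemma shift_exact d e r (A : tmodule d) (B : tmodule (d + e)) (C : tmodule e) :
    (r <= d)%N -> A 'X = shift_mx d r -> B 'X = shift_mx (d + e) r ->
    C 'X = shift_mx e 0 ->
  exists (f : tmorphism A B) (g : tmorphism B C),
    short_exact f g /\ tmor_mx f = col_mx 1%:M 0.
Proof.
move=> le_rd AX BX CX; rewrite shift_mx_block // in BX.
have fP : col_mx 1%:M 0 *m A 'X = B 'X *m col_mx 1%:M 0.
  by rewrite AX BX mul_col_mx mul_block_col mul1mx mul0mx !mulmx1 !mulmx0
    !addr0.
have gP : row_mx 0 1%:M *m B 'X = C 'X *m row_mx 0 1%:M.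
  by rewrite BX CX mul_mx_row mul_row_block !mul0mx !mul1mx !mulmx0 mulmx1
    !add0r.
pose f := TMorphism (tmorphism_eqX fP); pose g := TMorphism (tmorphism_eqX gP).
by exists f, g; split=> //; apply: short_exact_block.
Qed.

(** The constructor expects dimension [d.+1], whereas block decompositions produce [d + 1]. *)
Lemma iterated_Ga_addn1 d (L' : tmodule d) (L : tmodule (d + 1))
    (f : tmorphism L' L) (g : tmorphism L (Ga emb theta)) :
  iterated_Ga L' -> short_exact f g -> iterated_Ga L.
Proof.
move: L f g; rewrite addn1 => L f g; exact: IteratedGaS.
Qed.

(** The last coordinate is a quotient on which t is theta, that is [Ga]; the others form a submodule
    of the same shape. *)
Lemma iterated_Ga_shift d (L : tmodule d) :
  L 'X = shift_mx d 0 -> iterated_Ga L.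
Proof.
elim: d L => [|d IH] L LX; first exact: IteratedGa0.
move: L LX; rewrite -[d.+1]addn1 => L LX.
pose L' := tmodule_of_mx (shift_mx_nilpotent d 0).
have L'X : L' 'X = shift_mx d 0 by exact: eval_mxX.
have [|f [g [fg _]]] := @shift_exact d 1 0 L' L (Ga emb theta) (leq0n d) L'X LX.
  rewrite [LHS]eval_mxX; apply/matrixP => i j.
  by rewrite !mxE !ord1 /= !addr0.
exact: iterated_Ga_addn1 (IH _ L'X) fg.
Qed.

End TModuleTheory.

(** * Ext^1 and Ext^1_0 of Carlitz tensor powers in coordinates *)

Section CarlitzExt.
Variables (F : finFieldType) (K : fieldType) (emb : {rmorphism F -> K}).
Variables (theta : K) (m N r : nat).
Hypotheses (m_gt0 : (0 < m)%N) (r_gt0 : (0 < r)%N) (rmE : (r + m)%N = N.+1).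
Local Notation Ktau := (twisted emb).
Local Notation frob := (qfrob emb).
Local Notation tconst c := (skew_const (qfrob emb) c).
Local Notation tau := (skew_var (qfrob emb)).
Local Notation carlitz := (carlitz emb theta).
Local Notation red := (red emb theta m N).
Local Notation ext_poly := (@ext_poly F K emb theta m N).

Let le_mN : (m <= N)%N.
Proof. by rewrite -ltnS -rmE -{1}[m]add0n ltn_add2r. Qed.

Lemma shift_mx_points n k (v : 'cV[K^o]_n.+1) i :
  tau_mulmx (shift_mx emb theta n.+1 k) v i 0
  = theta * v i 0 + (if (i < n)%N then v (inord i.+1) 0 else 0)
    + (if i.+1 == k then frob (v 0 0) else 0).
Proof.
rewrite /shift_mx !tau_mulmxDl !mxE; congr (_ + _ + _).
- by have := tau_mulmx_const emb theta v i; rewrite mxE.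
- case: ltnP => [lt_i|le_n]; last first.
    rewrite big1 // => j _; rewrite mxE ltn_eqF ?tau_eval0l //.
    by rewrite (leq_trans (ltn_ord j)) ?ltnS.
  rewrite (bigD1 (inord i.+1)) //= mxE /= inordK // eqxx tau_eval_const scale1r.
  rewrite big1 ?addr0 // => j ne_j.
  rewrite mxE (_ : _ == _ = false) ?tau_eval0l //.
  by apply: contraNF ne_j => /eqP ji; apply/eqP/val_inj; rewrite /= inordK.
rewrite (bigD1 0) //= mxE andbT big1 ?addr0 => [|j ne_j].
  by case: eqP => _; rewrite ?tau_eval_var ?tau_eval0l.
by rewrite mxE -[_ == 0]/(j == 0) (negPf ne_j) andbF tau_eval0l.
Qed.

Variable X : tmodule emb theta N.+1.
Hypothesis XX : X 'X = shift_mx emb theta N.+1 r.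

(* Reversed, because a superdiagonal shift lowers the index while the        *)
(* multiplication by t - theta raises the degree.                            *)
Definition red_points (p : {poly K}) : points X K^o := \col_i (red p)`_(N - i).

Fact red_points_is_nmod_morphism : nmod_morphism red_points.
Proof.
have [red0 redD] := red_is_nmod_morphism emb theta le_mN.
by split=> [|p u]; apply/colP => i; rewrite !mxE ?red0 ?coef0 // redD coefD.
Qed.

HB.instance Definition _ := GRing.isNmodMorphism.Build _ _ red_points
  red_points_is_nmod_morphism.

Lemma red_points_t p : red_points (('X + theta%:P) * p) = 'X *: red_points p.
Proof.
apply/colP => i; rewrite -['X *: _]/(tau_mulmx (X 'X) (red_points p)) XX.
rewrite shift_mx_points !mxE coef_red_t ?leq_subr // subn0.
have := ltn_ord i; rewrite ltnS => le_i; congr (_ + _ + _).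
  rewrite subn_eq0; case: leqP => // lt_i.
  by rewrite inordK // subnS.
by congr (if _ then _ else _); lia.
Qed.

(** The scalar passes through the relations because [frob] fixes it; [ptau] is only semilinear over
    K. *)
Lemma red_pointsZ c p : red_points (emb c *: p) = c%:P *: red_points p.
Proof.
apply/colP => i; rewrite scale_points_const !mxE.
rewrite [RHS](_ : _ = (emb c *: red p)`_(N - i)); last by rewrite coefZ.
congr (_`_ _).
have [u pE] := redP emb theta m N p; set c' := emb c.
have frob_c : frob c' = c' by rewrite /frob /c' -rmorphXn expf_card.
rewrite -[p in LHS](subrK (red p)) pE scalerDr.
rewrite (red_is_nmod_morphism emb theta le_mN).2.
rewrite scalerBr -{2}frob_c -ptauZ -mul_polyC mulrCA mul_polyC red_relation //.
by rewrite add0r red_id // (leq_trans (size_scale_leq _ _)) // size_red.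
Qed.

Lemma red_points_eq0 p : red_points p = 0 -> red p = 0.
Proof.
move=> p0; apply/polyP => i; rewrite coef0.
have [le_i|lt_i] := leqP i N; last first.
  by rewrite nth_default // (leq_trans (size_red _ _ le_mN _)).
have /colP/(_ (inord (N - i))) := p0.
by rewrite !mxE inordK ?subKn // ltnS leq_subr.
Qed.

Definition ext_points (w : 'M[Ktau]_(N.+1, m)) : points X K^o :=
  red_points (ext_poly w).

Fact ext_points_is_nmod_morphism : nmod_morphism ext_points.
Proof. by split=> [|v w]; rewrite /ext_points ?raddf0 ?raddfD. Qed.

HB.instance Definition _ := GRing.isNmodMorphism.Build _ _ ext_points
  ext_points_is_nmod_morphism.

Lemma red_poly_rev (v : points X K^o) :
  exists2 p : {poly K}, red p = p & red_points p = v.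
Proof.
pose p : {poly K} := \poly_(k < N.+1) (v : 'cV[K^o]_N.+1) (inord (N - k)) 0.
have pE : red p = p by rewrite red_id ?size_poly.
exists p => //; apply/colP => i; rewrite mxE pE coef_poly ltnS leq_subr.
by rewrite subKn ?inord_val // -ltnS.
Qed.

Lemma ext_poly_const c w : ext_poly (tconst c *: w) = c *: ext_poly w.
Proof.
rewrite /ext_poly scaler_sumr; apply: eq_bigr => i _.
by rewrite linearZ /= row_polyZ skew_act_const scalerAr.
Qed.

(** Linearity in t holds because the correction in [ext_poly_mulGt] is a relation; [redP] and
    [ext_poly_inner] show that the kernel is inner. *)
Lemma Ext1_carlitz_iso :
  exists phi : {linear Ext1 (carlitz m) (carlitz N.+1) -> points X K^o},
  bijective phi /\ forall delta, phi (ext_class delta) = ext_points (delta 'X).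
Proof.
apply: (@Ext1_iso _ _ _ _ _ _ _ _ _ ext_points) => [w|c w|v|w].
- rewrite carlitzX /= /ext_points ext_poly_mulGt raddfB /= red_points_t.
  rewrite [X in _ - X](_ : _ = 0) ?subr0 //.
  by apply/colP => i; rewrite mxE red_relation // coef0 mxE.
- by rewrite /= /ext_points ext_poly_const red_pointsZ.
- have [p _ <-] := red_poly_rev v.
  by have [w <-] := ext_poly_surj emb theta m_gt0 N p; exists w.
rewrite !carlitzX; split=> [/red_points_eq0 w0|[U ->]].
  have [u] := redP emb theta m N (ext_poly w).
  by rewrite w0 subr0 => /(ext_poly_inner m_gt0).
rewrite /= /ext_points raddfB /= ext_poly_mulEt // ext_poly_mulGt opprB addrC.
rewrite subrK; apply/colP => i.
by rewrite mxE red_relation // coef0 mxE.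
Qed.

Lemma dvdXm_sum k (G : 'I_k -> {poly K}) :
  (forall i, 'X^m %| G i) -> 'X^m %| \sum_i G i.
Proof.
move=> dvdG; apply: (big_ind (fun u => 'X^m %| u)) => // u v.
exact: dvdp_add.
Qed.

(** Without constant term only positive iterates of [ptau] occur, and each value of [ptau] has the
    factor ['X^m]. *)
Lemma dvdXm_skew_act (x : Ktau) p : x`_0 = 0 ->
  'X^m %| skew_act (ptau emb theta m : {additive _ -> _}) x p.
Proof.
move=> x0; rewrite /skew_act; apply: dvdXm_sum.
case=> -[|k] lt_k /=; first by rewrite x0 scale0r dvdp0.
by rewrite -mul_polyC dvdp_mull // dvdp_mulIl.
Qed.

Lemma dvdXm_ext_poly w : lie w = 0 -> 'X^m %| ext_poly w.
Proof.
move=> w0; rewrite /ext_poly; apply: dvdXm_sum => i; rewrite dvdp_mull //.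
rewrite /row_poly; apply: dvdXm_sum => j; rewrite dvdXm_skew_act // mxE.
by have /matrixP/(_ i j) := w0; rewrite !mxE.
Qed.

(* tau e_1 = (t - theta)^m e_1, so the first column of w suffices.           *)
Lemma ext_poly_lie0 (h : {poly K}) : (size h <= N.+1)%N ->
  exists2 w : 'M[Ktau]_(N.+1, m), lie w = 0 & ext_poly w = 'X^m * h.
Proof.
move=> sz_h; pose e : 'rV[Ktau]_m := delta_mx 0 (Ordinal m_gt0).
exists (\matrix_i (tconst h`_(N - i) *: (tau *: e))).
  apply/matrixP => i j; rewrite !mxE mulrA [LHS]coef_skew_mul big_ord1 /=.
  by rewrite skew_mulVarE coefMX mul0r.
rewrite /ext_poly.
transitivity ('X^m * \sum_(i < N.+1) h`_(N - i) *: 'X^(N - i)).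
  rewrite mulr_sumr; apply: eq_bigr => i _; rewrite rowK !row_polyZ.
  rewrite row_poly_delta skew_act_const skew_act_var /= /ptau expr0 ptwistC.
  by rewrite /qfrob expr1n mulr1 -!scalerAr mulrC.
congr (_ * _); rewrite -[RHS](take_poly_id sz_h) /take_poly poly_def.
rewrite (reindex_inj rev_ord_inj) /=; apply: eq_bigr => i _.
by rewrite subSS subKn // -ltnS.
Qed.

(** Coordinate i is the coefficient of degree N - i, so r <= i means degree below m and the
    condition is divisibility by X^m. Reduction preserves it ([red_dvdXm]), and [ext_poly_lie0]
    lifts a reduced multiple to a w without constant term. *)
Lemma Ext10_carlitzP
    (phi : {linear Ext1 (carlitz m) (carlitz N.+1) -> points X K^o}) :
    injective phi ->
    (forall delta, phi (ext_class delta) = ext_points (delta 'X)) ->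
  forall x, x \in Ext10_pred (G := carlitz N.+1) <->
    (forall i : 'I_N.+1, (r <= i)%N -> (phi x : 'cV[K^o]_N.+1) i 0 = 0).
Proof.
move=> phi_inj phiE x; split=> [/asboolP[delta [d0 ->]] i le_ri|x0].
  rewrite phiE mxE; have /(red_dvdXm emb theta le_mN) := dvdXm_ext_poly d0.
  case/dvdpP => q ->; rewrite coefMXn ifT //; have := ltn_ord i; lia.
have [p pE px] := red_poly_rev (phi x).
have coef_p k : (k < m)%N -> p`_k = 0.
  move=> lt_k; have le_k : (k <= N)%N by rewrite (leq_trans (ltnW lt_k)).
  have := x0 (inord (N - k)); rewrite -px mxE pE inordK ?ltnS ?leq_subr //.
  by rewrite subKn //; apply; lia.
have pXm : p = 'X^m * drop_poly m p.
  rewrite -{1}(poly_take_drop m p) mulrC [X in X + _](_ : _ = 0) ?add0r //.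
  by apply/polyP => k; rewrite coef_take_poly coef0; case: ifP => // /coef_p.
have sz_p : (size (drop_poly m p) <= N.+1)%N.
  rewrite size_drop_poly (leq_trans (leq_subr _ _)) // -pE.
  exact: size_red.
have [w w0 wE] := ext_poly_lie0 sz_p.
have [delta dE] := biderivation_ofX (carlitz m) (carlitz N.+1) w.
apply/asboolP; exists delta; rewrite dE; split=> //.
by apply: phi_inj; rewrite phiE dE /ext_points wE -pXm.
Qed.

End CarlitzExt.

(** * Assembling the exact sequence and the description of Ext^1_0 *)

Theorem theorem1p2 (F : finFieldType) (K : fieldType)
    (emb : {rmorphism F -> K})
    (p : nat) (pcharK : p \in [pchar K])
    (perfectK : bijective (pFrobenius_aut pcharK))
    (iota : {rmorphism {poly F} -> K})
    (iota_linear : forall (c : F) (a : {poly F}), iota (c *: a) = emb c * iota a)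
    (m n : nat) (m_gt0 : (0 < m)%N) (n_gt0 : (0 < n)%N) (lt_mn : (m < n)%N) :
  let C k := carlitz emb (iota 'X) k in
  exists (d : nat) (X : tmodule emb (iota 'X) d) (L : tmodule emb (iota 'X) m)
         (phi : {linear Ext1 (C m) (C n) -> points X K^o})
         (f : tmorphism (C (n - m)%N) X) (g : tmorphism X L)
         (psi : {linear Ext10 (C m) (C n) -> points (C (n - m)%N) K^o}),
    [/\ bijective phi,
        short_exact f g,
        iterated_Ga L,
        bijective psi &
        forall x : Ext10 (C m) (C n), phi (val x) = tmor_points f (psi x)].
Proof.
move=> C; pose r := (n - m)%N; have r_gt0 : (0 < r)%N by rewrite subn_gt0.
rewrite /C -/r {C}; have : (r + m)%N = n by rewrite subnK // ltnW.
(* With n written [r.+1 + m], the dimension of X is a sum, as [shift_exact] requires, and is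
   convertible to [(r + m).+1], so that N is [r + m]. *)
move: r r_gt0 => [//|r] _ nE; rewrite -{}nE.
pose theta := iota 'X.
pose X := tmodule_of_mx (shift_mx_nilpotent emb theta (r.+1 + m) r.+1).
pose L := tmodule_of_mx (shift_mx_nilpotent emb theta m 0).
have XX : X 'X = shift_mx emb theta (r.+1 + m) r.+1 by exact: eval_mxX.
have LX : L 'X = shift_mx emb theta m 0 by exact: eval_mxX.
(* [carlitz_mx] in dimension [r.+1] is convertible to [shift_mx] with both parameters [r.+1]. *)
have [f [g [fg fE]]] :=
  shift_exact (leqnn r.+1) (carlitzX emb theta r.+1) XX LX.
have [phi [phi_bij phiE]] :=
  @Ext1_carlitz_iso F K emb theta m (r + m) r.+1 m_gt0 isT erefl X XX.
have phi0 := @Ext10_carlitzP F K emb theta m (r + m) r.+1 m_gt0 isT erefl X phi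
  (bij_inj phi_bij) phiE.
have fR v : tmor_points f v = col_mx v 0 :> 'cV[K^o]_(r.+1 + m).
  by rewrite /tmor_points fE tau_mulmx_col tau_mulmx1 tau_mulmx0.
have f_inj : injective (@tmor_points _ _ _ _ _ _ _ _ f K^o).
  by have [] := fg K^o.
(* On Ext^1_0 the last m coordinates of phi vanish and f includes the first [r.+1], so projecting to
   these loses nothing. *)
pose psi0 (x : Ext10 (carlitz emb theta m) (carlitz emb theta (r.+1 + m))) :
    points (carlitz emb theta r.+1) K^o :=
  usubmx (phi (val x) : 'cV[K^o]_(r.+1 + m)).
have psi0E x : phi (val x) = tmor_points f (psi0 x).
  rewrite fR; apply: etrans (esym (vsubmxK (phi (val x) : 'cV_(r.+1 + m)))) _.
  congr col_mx; apply/colP => i.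
  by rewrite !mxE; apply: (phi0 _).1; [apply: valP | rewrite /= leq_addr].
(* Linearity is inherited from phi through the injective linear map f. *)
have [a x y|psi psiE] := @linear_of _ _ _ psi0 _.
  apply: f_inj; rewrite tmor_points_linear -!psi0E.
  by rewrite -linearP; congr (phi _); rewrite linearP.
exists (r.+1 + m)%N, X, L, phi, f, g, psi; split=> // [||x].
- exact: iterated_Ga_shift.
- apply: inj_surj_bij => [x y|v].
    by rewrite !psiE => xy; apply/val_inj/(bij_inj phi_bij); rewrite !psi0E xy.
  have [phi' _ phi'K] := phi_bij; pose x := phi' (tmor_points f v).
  have x_in : x \in Ext10_pred (G := carlitz emb theta (r.+1 + m)).
    apply/phi0 => i le_i; rewrite phi'K fR; case: (@splitP r.+1 m i) => j ij.
      by have := ltn_ord j; rewrite -ij ltnNge le_i.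
    have -> : i = rshift r.+1 j by apply/val_inj.
    by apply: etrans (col_mxEd _ _ _ _) _; rewrite mxE.
  exists (Sub x x_in); apply: f_inj.
  by rewrite psiE -psi0E /= phi'K.
- by rewrite psiE.
Qed.
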